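(* Let $c\in[\sqrt3,2]$, let $u_1,\ldots,u_{2k}\in\mathbb T_n^{\bullet}$ and $v_1,\ldots,v_{2l}\in\mathbb T_n^{\circ}$ be black and white faces of $\mathbb T_n$ respectively, half of which (i.e. $k+l$ of the $2k+2l$ faces) are declared sources and the other half sinks, let $\rho(\ell)$ be the associated loop weights (defined in the context), and let $s$ be the number of white sinks. Then $$\mathbf E_{\mu_n}\Big[\prod_{i=1}^{2k}\sigma(u_i)\prod_{j=1}^{2l}\sigma(v_j)\Big]=(-1)^s\,\mathbf E_{\phi_n}\Big[\prod_{\ell\in L}\rho(\ell)\Big].$$
   Context: Six-vertex model. Fix $j_1,j_2\in\mathbb N$; $\mathbb T_n=(\mathbb Z/2nj_1\mathbb Z)\times(\mathbb Z/2nj_2\mathbb Z)$ is the square-lattice torus. An arrow configuration is an orientation of every edge with exactly two arrows pointing towards each vertex. $\mu_n$ is the probability measure on arrow configurations $\alpha$ of $\mathbb T_n$ with $\mu_n(\alpha)\propto c^{N(\alpha)}$, where $N(\alpha)$ is the number of vertices around which the arrows alternate between incoming and outgoing. Parameters. $q=(c^2-2)^2\in[1,4]$ and $\lambda\in[0,\pi/3]$ is given by $\sqrt q=2\cos\lambda$ (equivalently $c=2\cos(\lambda/2)$). Heights and spins. Faces of $\mathbb T_n$ are coloured black and white in a chessboard manner; $\mathbb T_n^\bullet$ and $\mathbb T_n^\circ$ denote the sets of black and white faces. To define heights on the torus, identify $\mathbb T_n$ with the box $\{-nj_1+1,\ldots,nj_1\}\times\{-nj_2+1,\ldots,nj_2\}\subset\mathbb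 Z^2$. Fix a white face $u_0$ next to the origin; $h(u_0)=\pm1$ with probability $1/2$ each, independently of $\alpha$ (this coin flip is included in $\mathbf E_{\mu_n}$). For any other face $u$, take a directed path $\gamma$ in the dual graph from $u_0$ to $u$ which does not step across the cut, i.e. does not step from $i$-th coordinate $nj_i$ to $i$-th coordinate $-nj_i+1$ or vice versa, $i=1,2$; then $h(u)-h(u_0)$ is the number of arrows of $\alpha$ crossing $\gamma$ from right to left minus the number crossing from left to right (this does not depend on the choice of such $\gamma$). The spins are $\sigma(u)=i^{h(u)}$, with $i$ the imaginary unit; they are real on black and imaginary on white faces. Loop measure. A fully packed loop configuration $L$ on $\mathbb T_n$ is obtained by choosing at each vertex one of the two ways of pairing the four incident edges into two noncrossing turns (each pairing two consecutive edges around the vertex); the edges then decompose into a collection $L$ of noncrossing closed loops, each edge being traversed exactly once. $\phi_n$ is the probability measure on such configurations with $\phi_n(L)\propto\sqrt q^{\,|L|}(2/\sqrt q)^{|L_{\rm nctr}|}$, where $|L|$ is the number of loops and $L_{\rm nctr}$ is the set of loops that are noncontractible on the torus. For an oriented loop $\vec\ell$, $\mathrm w(\vec\ell)=\frac14(\#\text{left turns}-\#\text{right turns})$ is its total winding number; it equals $+1$ (resp. $-1$) for contractible counterclockwise (resp. clockwise) loops and $0$ for noncontractible ones. $-\vec\ell$ denotes the reversed loop. Zipper and $\rho$. Fix $k+l$ directed paths in the dual of $\mathbb T_n$ which connect pairwise the sources to the sinks (each path goes from a source to a sink, each source and each sink being used once). Let $\Gamma$ be the collection of directed edges of $\mathbb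 T_n$ which cross these paths from right to left (one edge may cross several paths, and is then counted with multiplicity). For a collection $H$ of directed edges put $\epsilon(H)=i^{|\Gamma\cap H|}(-i)^{|\Gamma\cap(-H)|}$, where $-H$ is the set of reversed edges of $H$. For an unoriented loop $\ell$ with orientations $\vec\ell$ and $-\vec\ell$ (identified with their sets of directed edges), $$\rho(\ell)=\frac{e^{i\lambda \mathrm w(\vec\ell)}\epsilon(\vec\ell)+e^{i\lambda \mathrm w(-\vec\ell)}\epsilon(-\vec\ell)}{e^{i\lambda \mathrm w(\vec\ell)}+e^{i\lambda \mathrm w(-\vec\ell)}}.$$
   Formalization: The directed paths of the zipper joining sources to sinks are required not to step across the cut, as for the height paths; for arbitrary dual paths the identity fails, e.g. k=0, l=1, v_1=v_2 and a path winding once around the torus. *)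

(* Defs.v *)
From Stdlib Require Import Relation_Operators.
From mathcomp Require Import all_boot all_order all_algebra.
From mathcomp Require Import complex.
From mathcomp Require Import boolp reals trigo.

Set Implicit Arguments.
Unset Strict Implicit.
Unset Printing Implicit Defensive.

Import Order.TTheory GRing.Theory Num.Theory.
Local Open Scope ring_scope.
Local Open Scope complex_scope.

(* The torus has size (2 n j1) x (2 n j2) with n, j1, j2 > 0, so that both
   moduli are at least 2 and 'Z_m really is Z/mZ. *)
Definition vertex (n j1 j2 : nat) : Type :=
  ('Z_(2 * n * j1) * 'Z_(2 * n * j2))%type.

(* The face f is the unit square whose lower left corner is the vertex f. *)
Definition face (n j1 j2 : nat) : Type :=
  ('Z_(2 * n * j1) * 'Z_(2 * n * j2))%type.

(* Directions in counterclockwise order: 0 = East, 1 = North, 2 = West,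
   3 = South.  Hence d + 1 is d turned left, d - 1 is d turned right and d + 2
   is the direction opposite to d. *)
Definition dir : Type := 'Z_4.

(* The directed edge (v, d) leaves the vertex v in direction d.  Recording the
   direction keeps parallel edges apart on a torus of width 2. *)
Definition dart (n j1 j2 : nat) : Type := (vertex n j1 j2 * dir)%type.

Definition dvec (n j1 j2 : nat) (d : dir) : vertex n j1 j2 :=
  nth 0 [:: (1, 0); (0, 1); (-1, 0); (0, -1)] d.

Definition dart_head (n j1 j2 : nat) (e : dart n j1 j2) : vertex n j1 j2 :=
  e.1 + dvec n j1 j2 e.2.

Definition rev_dart (n j1 j2 : nat) (e : dart n j1 j2) : dart n j1 j2 :=
  (dart_head e, e.2 + 2).

Definition rev_darts (n j1 j2 : nat) (H : {set dart n j1 j2}) :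
  {set dart n j1 j2} := [set rev_dart e | e in H].

(* An orientation of all edges is encoded by the set of its arrows; the arrow
   on the edge leaving v in direction d points towards v iff (v, d) is not in
   this set. *)
Definition orientation (n j1 j2 : nat) (A : {set dart n j1 j2}) : bool :=
  [forall e, (e \in A) != (rev_dart e \in A)].

Definition arrow_config (n j1 j2 : nat) (A : {set dart n j1 j2}) : bool :=
  orientation A &&
  [forall v : vertex n j1 j2,
     #|[set d : dir | rev_dart ((v, d) : dart n j1 j2) \in A]| == 2%N].

Definition alternating (n j1 j2 : nat) (A : {set dart n j1 j2}) :
  {set vertex n j1 j2} :=
  [set v | [forall d : dir, ((v, d) \in A) != ((v, d + 1) \in A)]].

Definition arrow_weight (R : realType) (n j1 j2 : nat) (c : R)
  (A : {set dart n j1 j2}) : R := c ^+ #|alternating A|.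

(* Expectation of f under the probability measure on {x | P x} whose mass
   function is proportional to w. *)
Definition expect (R : realType) (T : finType) (P : pred T) (w : T -> R)
  (f : T -> R[i]) : R[i] :=
  (\sum_(x | P x) (w x)%:C * f x) / (\sum_(x | P x) w x)%:C.

(* The weight does not depend on the second component, so that this is
   a fair coin independent of the arrow configuration. *)
Definition E_mu (R : realType) (n j1 j2 : nat) (c : R)
  (f : {set dart n j1 j2} -> bool -> R[i]) : R[i] :=
  expect (fun x : {set dart n j1 j2} * bool => arrow_config x.1)
         (fun x => arrow_weight c x.1) (fun x => f x.1 x.2).

Definition chessboard (n j1 j2 : nat) (black : pred (face n j1 j2)) : Prop :=
  forall (f : face n j1 j2) (d : dir), black (f + dvec n j1 j2 d) = ~~ black f.

Definition corner (n j1 j2 : nat) (f : face n j1 j2) (d : dir) :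
  vertex n j1 j2 :=
  f + nth 0 [:: (1, 0); (1, 1); (0, 1); (0, 0)] d.

Definition next_to (n j1 j2 : nat) (f : face n j1 j2) (v : vertex n j1 j2) :
  bool := [exists d : dir, corner f d == v].

(* A path in the dual graph is given by its first face and the sequence of the
   directions of its steps. *)
Definition dual_step (n j1 j2 : nat) (f : face n j1 j2) (d : dir) :
  face n j1 j2 := f + dvec n j1 j2 d.

Definition dual_end (n j1 j2 : nat) (f : face n j1 j2) (p : seq dir) :
  face n j1 j2 := foldl (@dual_step n j1 j2) f p.

(* The edge crossed by the step from f in direction d, directed from the right
   to the left of this step: it starts at the corner of f which lies in front
   and to the right. *)
Definition right_to_left (n j1 j2 : nat) (f : face n j1 j2) (d : dir) :
  dart n j1 j2 := (corner f d, d + 1).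

Fixpoint crossings (n j1 j2 : nat) (f : face n j1 j2) (p : seq dir) :
  seq (dart n j1 j2) :=
  if p is d :: p' then right_to_left f d :: crossings (dual_step f d) p'
  else [::].

(* In the box {-n j1 + 1, ..., n j1} x {-n j2 + 1, ..., n j2} the cut lies
   between the i-th coordinates n ji and -n ji + 1; an East step from the
   column n j1 or a West step from the column -n j1 + 1 crosses it. *)
Definition crosses_cut (n j1 j2 : nat) (f : face n j1 j2) (d : dir) : bool :=
  nth false [:: f.1 == (n * j1)%:R; f.2 == (n * j2)%:R;
                f.1 == - (n * j1)%:R + 1; f.2 == - (n * j2)%:R + 1] d.

Fixpoint avoids_cut (n j1 j2 : nat) (f : face n j1 j2) (p : seq dir) : bool :=
  if p is d :: p' then ~~ crosses_cut f d && avoids_cut (dual_step f d) p'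
  else true.

Definition box_path (n j1 j2 : nat) (f g : face n j1 j2) (p : seq dir) : bool :=
  avoids_cut f p && (dual_end f p == g).

(* gamma u is the chosen dual path from u0 to u, and the coin b gives
   h(u0) = (-1)^b. *)
Definition height (n j1 j2 : nat) (u0 : face n j1 j2)
  (gamma : face n j1 j2 -> seq dir) (A : {set dart n j1 j2}) (b : bool)
  (u : face n j1 j2) : int :=
  let G := crossings u0 (gamma u) in
  (-1) ^+ b + (count [in A] G)%:Z - (count [in rev_darts A] G)%:Z.

Definition spin (R : realType) (n j1 j2 : nat) (u0 : face n j1 j2)
  (gamma : face n j1 j2 -> seq dir) (A : {set dart n j1 j2}) (b : bool)
  (u : face n j1 j2) : R[i] := ('i : R[i]) ^ height u0 gamma A b u.

(* A fully packed loop configuration: at v the pairs of edges are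
   {East, North}, {West, South} if L v, and {North, West}, {South, East}
   otherwise. *)
Definition loop_config (n j1 j2 : nat) : Type := {ffun vertex n j1 j2 -> bool}.

Definition partner (b : bool) (d : dir) : dir :=
  if odd d (+) b then d + 1 else d - 1.

Definition next_dart (n j1 j2 : nat) (L : loop_config n j1 j2)
  (e : dart n j1 j2) : dart n j1 j2 :=
  (dart_head e, partner (L (dart_head e)) (e.2 + 2)).

Definition oriented_loops (n j1 j2 : nat) (L : loop_config n j1 j2) :
  {set {set dart n j1 j2}} :=
  [set [set f in orbit (next_dart L) e] | e : dart n j1 j2].

(* An unoriented loop is the pair of its two orientations. *)
Definition loops (n j1 j2 : nat) (L : loop_config n j1 j2) :
  {set {set {set dart n j1 j2}}} :=
  [set [set O; rev_darts O] | O in oriented_loops L].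

(* Homotopy of walks on the torus, fixing endpoints, is generated by inserting
   backtracks and boundaries of faces.  These moves are the same at every
   vertex, so only the sequence of directions of the walk matters. *)
Inductive elementary_homotopy : seq dir -> seq dir -> Prop :=
| backtrack (p q : seq dir) (d : dir) :
    elementary_homotopy (p ++ q) (p ++ [:: d; d + 2] ++ q)
| around_face (p q : seq dir) (d : dir) :
    elementary_homotopy (p ++ q) (p ++ [:: d; d + 1; d + 2; d + 3] ++ q).

Definition homotopic : seq dir -> seq dir -> Prop :=
  clos_refl_sym_trans (seq dir) elementary_homotopy.

Definition contractible (n j1 j2 : nat) (L : loop_config n j1 j2)
  (l : {set {set dart n j1 j2}}) : Prop :=
  exists2 O, O \in l &
  exists2 e, e \in O & homotopic [seq f.2 | f <- orbit (next_dart L) e] [::].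

Definition noncontractible_loops (n j1 j2 : nat) (L : loop_config n j1 j2) :
  {set {set {set dart n j1 j2}}} :=
  [set l in loops L | ~~ `[< contractible L l >]].

Definition qpar (R : realType) (c : R) : R := (c ^+ 2 - 2) ^+ 2.

Definition loop_weight (R : realType) (n j1 j2 : nat) (c : R)
  (L : loop_config n j1 j2) : R :=
  Num.sqrt (qpar c) ^+ #|loops L| *
  (2 / Num.sqrt (qpar c)) ^+ #|noncontractible_loops L|.

Definition E_phi (R : realType) (n j1 j2 : nat) (c : R)
  (f : loop_config n j1 j2 -> R[i]) : R[i] :=
  expect xpredT (@loop_weight R n j1 j2 c) f.

Definition winding (R : realType) (n j1 j2 : nat) (L : loop_config n j1 j2)
  (O : {set dart n j1 j2}) : R :=
  (#|[set e in O | (next_dart L e).2 == e.2 + 1]|%:R -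
   #|[set e in O | (next_dart L e).2 == e.2 - 1]|%:R) / 4.

Definition expi (R : realType) (x : R) : R[i] := cos x +i* sin x.

(* Gamma is a list because it is counted with multiplicity. *)
Definition epsilon (R : realType) (n j1 j2 : nat) (Gamma : seq (dart n j1 j2))
  (H : {set dart n j1 j2}) : R[i] :=
  'i ^+ count [in H] Gamma * (- 'i) ^+ count [in rev_darts H] Gamma.

Definition rho (R : realType) (n j1 j2 : nat) (lam : R)
  (Gamma : seq (dart n j1 j2)) (L : loop_config n j1 j2)
  (l : {set {set dart n j1 j2}}) : R[i] :=
  (\sum_(O in l) expi (lam * winding R L O) * epsilon R Gamma O) /
  (\sum_(O in l) expi (lam * winding R L O)).

Definition marked (n j1 j2 k l : nat) (u : 'I_(2 * k) -> face n j1 j2)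
  (v : 'I_(2 * l) -> face n j1 j2) (x : 'I_(2 * k) + 'I_(2 * l)) :
  face n j1 j2 :=
  match x with inl i => u i | inr j => v j end.

(* S is the set of sources and its complement the set of sinks.  The t-th path
   joins the source a t to the sink b t; since S is half of the marked faces,
   injectivity of a and b means that each source and each sink is used once.
   As for the paths defining the heights, the paths stay in the box: rerouting
   one of them around the torus would in general change the loop weights of
   noncontractible loops and the expectation, but not the spins. *)
Definition zipper (n j1 j2 k l : nat) (u : 'I_(2 * k) -> face n j1 j2)
  (v : 'I_(2 * l) -> face n j1 j2) (S : {set 'I_(2 * k) + 'I_(2 * l)})
  (a b : 'I_(k + l) -> 'I_(2 * k) + 'I_(2 * l)) (p : 'I_(k + l) -> seq dir) :
  Prop :=
  [/\ injective a, injective b,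
      forall t, a t \in S, forall t, b t \notin S &
      forall t, box_path (marked u v (a t)) (marked u v (b t)) (p t)].

Definition zipper_edges (n j1 j2 k l : nat) (u : 'I_(2 * k) -> face n j1 j2)
  (v : 'I_(2 * l) -> face n j1 j2)
  (a : 'I_(k + l) -> 'I_(2 * k) + 'I_(2 * l)) (p : 'I_(k + l) -> seq dir) :
  seq (dart n j1 j2) :=
  flatten [seq crossings (marked u v (a t)) (p t) | t <- enum 'I_(k + l)].

Definition white_sinks (k l : nat) (S : {set 'I_(2 * k) + 'I_(2 * l)}) : nat :=
  #|[set j : 'I_(2 * l) | inr j \notin S]|.

(* Main.v *)
From Stdlib Require Import Relation_Operators.
Require Import Defs.
From mathcomp Require Import all_boot all_order all_algebra.
From mathcomp Require Import complex.
From mathcomp Require Import boolp reals trigo.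
From mathcomp Require Import zify ring lra.
Set Implicit Arguments.
Unset Strict Implicit.
Unset Printing Implicit Defensive.
Import Order.TTheory GRing.Theory Num.Theory.
Local Open Scope ring_scope.

(** The identity is the Baxter-Kelland-Wu coupling of the six-vertex model with
fully packed loops, with a defect line carried along.

Expand every vertex of an arrow configuration A into the pairings of its four
edges that always pair an incoming with an outgoing arrow.  A vertex whose
arrows alternate has two such pairings, one producing two left turns and one
producing two right turns; any other vertex has exactly one, producing one
left and one right turn.  Give a left turn the phase e^(i lam/4) and a right
turn the inverse phase: the two choices at an alternating vertex add up to
2 cos(lam/2) = c, and the other vertices contribute 1 (vertex_sum).  Hence
c^N(A) is the sum, over the loop configurations L that A follows, of the total
phase of the turns.  Conversely, for fixed L the configurations A that follow
L are the independent choices of an orientation of each loop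
(prod_loops_expand), and the turns of one oriented loop O contribute
e^(i lam w(O)).  As epsilon is multiplicative over the edges, both sides of the
theorem become the same double sum (partition_identity).

What is left on the loop side is that the two orientations of a loop have total
phase 2 cos lam = sqrt q if the loop is contractible and 2 otherwise; that is,
that its winding number is +1 or -1 in the first case and 0 in the second
(total_turn_loop).  This is a discrete form of Hopf's Umlaufsatz, proved as he
did by deforming tangents into secants.  The loop is unrolled to the plane and
replaced by the path of the midpoints of its edges, which visits no point
twice before it closes up, because the loop uses no edge twice and never runs back along itself
(midpoint_walk_inj).  The rotation of a family of nonzero vectors is measured
by its signed crossings of a fixed ray, and crossings do not change under the
deformation (cross_cell).  If the loop is not contractible, the tangents deform
into the secants joining each point to its translate by a full period; these
are constant, so the rotation is zero (total_turn_noncontractible).  If the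
loop is contractible, the secants are based at a lowest point first and then
end there, so that they make one half turn twice (total_turn_from_bottom).
Contractibility itself only depends on the displacement of the unrolled loop
(homotopic_nil).

On the spin side, the ice rule makes the height the potential of a curl-free
field on the box (curl_free), so heights may be compared along any path that
avoids the cut (net_crossing_box_path).  Along the path of the zipper from a
source to its sink this turns the product of the two spins into the square of
the spin of the source times a power of the imaginary unit, and these powers
multiply to epsilon of A.  The square is 1 at black and -1 at white faces, and
the number of white sources has the parity of the number of white sinks
(spins_product). *)

(** * Crossings of a ray *)

Lemma dir_ind (P : dir -> Prop) : P 0 -> P 1 -> P 2 -> P 3 -> forall d, P d.
Proof.
move=> P0 P1 P2 P3 [[|[|[|[|//]]]] i].
- by rewrite (_ : Ordinal i = 0) //; apply: val_inj.
- by rewrite (_ : Ordinal i = 1) //; apply: val_inj.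
- by rewrite (_ : Ordinal i = 2) //; apply: val_inj.
- by rewrite (_ : Ordinal i = 3) //; apply: val_inj.
Qed.

Definition unit_vec (d : dir) : int * int :=
  nth 0 [:: (1, 0); (0, 1); (-1, 0); (0, -1)] d.

(** The ray starts at the origin and runs just below the positive first axis, so
that no lattice point lies on it. *)
Definition ray_cross (p q : int * int) : int :=
  ((p.2 < 0) && (0 <= q.2) && (0 < q.1))%:Z
  - ((q.2 < 0) && (0 <= p.2) && (0 < p.1))%:Z.

Lemma ray_crossC p q : ray_cross p q = - ray_cross q p.
Proof. by rewrite opprB. Qed.

(** The ray leaves the origin, so it can end inside an elementary square only if
the origin is a corner of it; otherwise both ways around the square have the
same signed number of crossings.  The parity hypothesis, which holds for
differences of midpoints, keeps the origin away from the centre. *)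
Lemma ray_cross_diamond (x y m : int) (l r b t : int * int) :
  x + y = 2 * m + 1 ->
  l = (x - 1, y) -> r = (x + 1, y) -> b = (x, y - 1) -> t = (x, y + 1) ->
  l != 0 -> r != 0 -> b != 0 -> t != 0 ->
  ray_cross b r + ray_cross r t = ray_cross b l + ray_cross l t.
Proof.
move=> xy -> -> -> ->.
rewrite /ray_cross -!pair_eqE /pair_eq /= => l0 r0 b0 t0.
have [y_lt|y_ge] := ltrP y (-1).
  have [-> -> ->] : [/\ (0 <= y + 1) = false, (0 <= y) = false &
    (0 <= y - 1) = false] by split; lia.
  by rewrite !andbF.
have [y_gt|y_le] := ltrP 0 y.
  have [-> -> ->] : [/\ (y + 1 < 0) = false, (y < 0) = false &
    (y - 1 < 0) = false] by split; lia.
  by [].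
have [y0|y1] : y = 0 \/ y = -1 by lia.
  by rewrite y0 /=; have -> : (0 < x - 1) = (0 < x + 1) by lia.
by rewrite y1 /=; lia.
Qed.

Definition diagonal (s : int * int) : bool := (`|s.1| == 1) && (`|s.2| == 1).

Lemma diagonalE s : diagonal s ->
  [\/ s = (1, 1), s = (-1, 1), s = (-1, -1) | s = (1, -1)].
Proof.
case: s => x y /andP[/= xE yE].
have [->|->] : x = 1 \/ x = -1 by lia.
all: have [->|->] : y = 1 \/ y = -1 by lia.
all: by [constructor 1|constructor 2|constructor 3|constructor 4].
Qed.

Lemma pairE (a b c d : int) : a = c -> b = d -> (a, b) = (c, d).
Proof. by move=> -> ->. Qed.

(** Reads the four corners of an elementary square as the left, right, bottom and
top corner of the diamond with the given centre; the diamond is then traversed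
from another corner, whence the sign changes. *)
Ltac square_of_diamond cx cy cm l r b t :=
  (have H : cx + cy = 2 * cm + 1 by lia);
  match type of l with is_true (?L != 0) =>
  match type of r with is_true (?R != 0) =>
  match type of b with is_true (?B != 0) =>
  match type of t with is_true (?T != 0) =>
  (have EL : L = (cx - 1, cy) by apply: pairE => /=; lia);
  (have ER : R = (cx + 1, cy) by apply: pairE => /=; lia);
  (have EB : B = (cx, cy - 1) by apply: pairE => /=; lia);
  (have ET : T = (cx, cy + 1) by apply: pairE => /=; lia);
  have := ray_cross_diamond H EL ER EB ET l r b t
  end end end end;
  match goal with |- _ -> ray_cross ?p ?a + ray_cross _ ?q = ray_cross _ ?b + _ =>
    have := (ray_crossC p a, ray_crossC p b, ray_crossC a q, ray_crossC b q)
  end; move=> [[[]]]; clear; move=> *; lra.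

(** Deforming one corner of a path across an elementary square does not change
its crossings.  The shape p + s - t is the one met when both ends of a secant
move: its far end by s and its near end by t. *)
Lemma ray_cross_cell (x y m : int) (s t : int * int) :
  diagonal s -> diagonal t -> x + y = 2 * m ->
  let p := (x, y) in
  p != 0 -> p + s != 0 -> p - t != 0 -> p + s - t != 0 ->
  ray_cross p (p + s) + ray_cross (p + s) (p + s - t) =
  ray_cross p (p - t) + ray_cross (p - t) (p + s - t).
Proof.
move=> sd td xy p p0 ps pt pst.
have [E|st] := eqVneq s t.
  by rewrite E addrK [ray_cross p _]ray_crossC addNr [ray_cross p _]ray_crossC addNr.
have [E|sNt] := eqVneq s (- t); first by rewrite -E.
case: (diagonalE sd) st sNt ps pt pst => ->; case: (diagonalE td) => -> //= _ _ ps pt pst.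
- by square_of_diamond (x + 1) y m p0 pst pt ps.
- by square_of_diamond x (y + 1) m pt ps p0 pst.
- by square_of_diamond (x - 1) y (m - 1) pst p0 pt ps.
- by square_of_diamond x (y + 1) m ps pt p0 pst.
- by square_of_diamond x (y - 1) (m - 1) ps pt pst p0.
- by square_of_diamond (x - 1) y (m - 1) pst p0 ps pt.
- by square_of_diamond x (y - 1) (m - 1) pt ps pst p0.
- by square_of_diamond (x + 1) y m p0 pst ps pt.
Qed.

(** * Total turn of a lattice path that always turns *)

Definition upper (v : int * int) : bool :=
  (0 < v.2) || ((v.2 == 0) && (0 < v.1)).

Lemma ray_cross_upper p q : upper p -> upper q -> ray_cross p q = 0.
Proof. by rewrite /upper /ray_cross => up uq; lia. Qed.

Lemma ray_cross_lower p q : upper p -> upper q -> ray_cross (- p) (- q) = 0.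
Proof. by rewrite /upper /ray_cross /= => up uq; lia. Qed.

(** At the lowest point of a closed path, s is the step that leaves it and t the
step that reaches it.  The corner cut off there contributes the first two
terms, the turn from t to s the other two; whichever way the path runs around,
exactly one of the two crosses the ray. *)
Lemma ray_cross_bottom s t :
  diagonal s -> diagonal t -> upper s -> upper (- t) -> s + t != 0 ->
  `|ray_cross (- t) (- t - s) + ray_cross (- t - s) (- s) +
    (ray_cross t (t + s) + ray_cross (t + s) s)| = 1.
Proof. by move=> /diagonalE[]-> /diagonalE[]->. Qed.

Section TurningPath.
Variable d : nat -> dir.
Hypothesis d_turn : forall i, d i.+1 = d i + 1 \/ d i.+1 = d i - 1.

(** Twice the segment between the midpoints of two consecutive edges: doubling
keeps the midpoints integral. *)
Definition corner_step (i : nat) : int * int :=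
  unit_vec (d i) + unit_vec (d i.+1).

Definition midpoint (i : nat) : int * int := \sum_(m < i) corner_step m.

Definition quarter_turn (i : nat) : int :=
  if d i.+1 == d i + 1 then 1 else -1.

(** The corner step is diagonal; this is the index of its quadrant, counted from
the north-east one. *)
Definition quadrant (i : nat) : int :=
  (if d i.+1 == d i + 1 then d i else d i.+1)%:Z.

(** Crossings of the ray by the secant from the i-th to the j-th midpoint while
its far end (col_cross) or its near end (row_cross) advances by one step. *)
Definition col_cross (i j : nat) : int :=
  ray_cross (midpoint j - midpoint i) (midpoint j.+1 - midpoint i).

Definition row_cross (i j : nat) : int :=
  ray_cross (midpoint j - midpoint i) (midpoint j - midpoint i.+1).

Lemma midpointS i : midpoint i.+1 = midpoint i + corner_step i.
Proof. by rewrite /midpoint big_ord_recr. Qed.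

Lemma corner_step_diagonal i : diagonal (corner_step i).
Proof.
rewrite /corner_step; case: (d_turn i) => ->; move: (d i).
all: by apply: dir_ind.
Qed.

Lemma midpoint_even i j :
  exists m, (midpoint j - midpoint i).1 + (midpoint j - midpoint i).2 = 2 * m.
Proof.
have E k : exists m, (midpoint k).1 + (midpoint k).2 = 2 * m.
  elim: k => [|k [m IH]]; first by exists 0; rewrite /midpoint big_ord0.
  rewrite midpointS; move: (corner_step k) (corner_step_diagonal k) => s.
  case: (midpoint k) IH => x y /= xy /diagonalE.
  by case=> -> /=; [exists (m + 1)|exists m|exists (m - 1)|exists m]; lia.
have [mi Ei] := E i; have [mj Ej] := E j; exists (mj - mi) => /=.
lia.
Qed.

(** Invariance under deformation: the secants of a path without multiple points
form a family of nonzero vectors indexed by pairs of points, and its crossings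
are additive over the cells of this index set. *)
Lemma cross_cell i j :
  midpoint j != midpoint i -> midpoint j.+1 != midpoint i ->
  midpoint j != midpoint i.+1 -> midpoint j.+1 != midpoint i.+1 ->
  col_cross i j + row_cross i j.+1 = row_cross i j + col_cross i.+1 j.
Proof.
have [m] := midpoint_even i j.
rewrite -!(subr_eq0 (midpoint _)) /col_cross /row_cross.
have -> : midpoint j.+1 - midpoint i =
    midpoint j - midpoint i + corner_step j by rewrite midpointS addrAC.
have -> : midpoint j - midpoint i.+1 =
    midpoint j - midpoint i - corner_step i by rewrite midpointS opprD addrA.
have -> : midpoint j.+1 - midpoint i.+1 =
    midpoint j - midpoint i + corner_step j - corner_step i.
  by rewrite !midpointS opprD addrA; congr (_ - _); rewrite addrAC.
case: (midpoint j - midpoint i) => x y xy ? ? ? ?.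
by apply: (ray_cross_cell (corner_step_diagonal j) (corner_step_diagonal i) xy).
Qed.

(** The corner step turns by the mean of the two quarter turns at its ends, and
it crosses the ray exactly when its quadrant passes between 3 and 0. *)
Lemma quarter_turn_cross i :
  quarter_turn i + quarter_turn i.+1 =
  8 * (col_cross i i.+1 + row_cross i i.+2) +
  2 * (quadrant i.+1 - quadrant i).
Proof.
rewrite /col_cross /row_cross.
have -> : midpoint i.+1 - midpoint i = corner_step i.
  by rewrite midpointS addrAC subrr add0r.
have -> : midpoint i.+2 - midpoint i = corner_step i + corner_step i.+1.
  by rewrite !midpointS !(addrAC _ _ (- _)) subrr add0r.
have -> : midpoint i.+2 - midpoint i.+1 = corner_step i.+1.
  by rewrite (midpointS i.+1) addrAC subrr add0r.
rewrite /quarter_turn /quadrant /corner_step.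
case: (d_turn i.+1) => ->; case: (d_turn i) => ->; move: (d i).
all: by apply: dir_ind.
Qed.

Section Periodic.
Variable N : nat.
Hypothesis d_per : forall i, d (i + N) = d i.

Lemma corner_step_periodic i : corner_step (i + N) = corner_step i.
Proof. by rewrite /corner_step -addSn !d_per. Qed.

Lemma midpoint_periodic i : midpoint (i + N) = midpoint i + midpoint N.
Proof.
elim: i => [|i IH]; first by rewrite {2}/midpoint big_ord0 add0r.
by rewrite addSn !midpointS IH corner_step_periodic addrAC.
Qed.

Lemma quadrant_periodic i : quadrant (i + N) = quadrant i.
Proof. by rewrite /quadrant -addSn !d_per. Qed.

Lemma sum_shift_periodic (f : nat -> int) m :
  (forall i, f (i + N) = f i)%N -> \sum_(i < N) f (m + i)%N = \sum_(i < N) f i.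
Proof.
move=> f_per; elim: m => [//|m <-].
apply: (addrI (f m)).
have E : \sum_(i < N.+1) f (m + i)%N = f m + \sum_(i < N) f (m.+1 + i)%N.
  rewrite big_ord_recl addn0; congr (_ + _).
  by apply: eq_bigr => i _; rewrite lift0 addnS addSn.
by rewrite -E big_ord_recr /= f_per addrC.
Qed.

(** Over a period the quadrants telescope: the total turn is four times the
number of crossings by the tangents. *)
Lemma total_turn_cross :
  \sum_(i < N) quarter_turn i =
  4 * \sum_(i < N) (col_cross i i.+1 + row_cross i i.+2).
Proof.
have t_per i : quarter_turn (i + N) = quarter_turn i.
  by rewrite /quarter_turn -addSn !d_per.
have shift := sum_shift_periodic 1 t_per.
have tel : \sum_(i < N) (quadrant i.+1 - quadrant i) = 0.
  rewrite -(big_mkord xpredT (fun i => quadrant i.+1 - quadrant i)).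
  by rewrite telescope_sumr // -[N in quadrant N]add0n quadrant_periodic subrr.
have : \sum_(i < N) (quarter_turn i + quarter_turn (1 + i)%N) =
       \sum_(i < N) (8 * (col_cross i i.+1 + row_cross i i.+2) +
         2 * (quadrant i.+1 - quadrant i)).
  by apply: eq_bigr => i _; rewrite add1n quarter_turn_cross.
rewrite [LHS]big_split [RHS]big_split -!big_distrr tel.
move: shift; set t := \sum_(i < N) quarter_turn i => -> /=.
set x := \sum_(i < N) _; lra.
Qed.

Lemma col_cross_periodic i j : col_cross (i + N) (j + N) = col_cross i j.
Proof.
have E (x y z : int * int) : x + z - (y + z) = x - y.
  by rewrite opprD addrACA subrr addr0.
by rewrite /col_cross -addSn !midpoint_periodic !E.
Qed.

(** Increasing the length of all secants by one step is a deformation; once the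
length is a whole period the secants are all equal to the displacement. *)
Lemma total_turn_noncontractible :
  midpoint N != 0 -> (forall i j, (i < j)%N -> midpoint i != midpoint j) ->
  \sum_(i < N) quarter_turn i = 0.
Proof.
move=> mN inj; rewrite total_turn_cross.
have ne i j : (i < j)%N -> midpoint j != midpoint i by rewrite eq_sym; apply: inj.
pose W k := \sum_(i < N) (col_cross i (i + k.+1)%N + row_cross i (i + k.+1).+1).
have WS k : W k.+1 = W k.
  transitivity (\sum_(i < N) (row_cross i (i + k.+1).+1 +
    col_cross (1 + i)%N ((1 + i) + k.+1)%N)).
    apply: eq_bigr => i _; rewrite add1n addSn !addnS.
    by apply: cross_cell; apply: ne; lia.
  rewrite big_split /= (sum_shift_periodic 1 (f := fun i => col_cross i (i + k.+1))).
    by rewrite -big_split; apply: eq_bigr => i _; rewrite addrC.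
  by move=> i; rewrite -[RHS]col_cross_periodic addnAC.
have W0 k : W k = W 0 by elim: k => // k <-; rewrite WS.
have N0 : (0 < N)%N.
  by case: N mN => //; rewrite /midpoint big_ord0 eqxx.
have -> : \sum_(i < N) (col_cross i i.+1 + row_cross i i.+2) = W 0.
  by apply: eq_bigr => i _; rewrite !addnS addn0.
rewrite -(W0 N.-1) /W big1 ?mulr0 // => i _; rewrite prednK //.
rewrite /col_cross /row_cross -addSn !midpoint_periodic.
have E (x y : int * int) : x + y - x = y by rewrite addrAC subrr add0r.
by rewrite !E ray_crossC addNr.
Qed.

Section Closed.
Hypothesis closed : midpoint N = 0.
Hypothesis simple :
  forall i j, (i < j)%N -> (j < i + N)%N -> midpoint i != midpoint j.

Lemma row_cross_telescope i k j : (i + k < j)%N -> (j.+1 < i + N)%N ->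
  \sum_(m < k) row_cross (i + m)%N j.+1 =
  \sum_(m < k) row_cross (i + m)%N j + col_cross (i + k)%N j - col_cross i j.
Proof.
elim: k => [|k IH] ikj jN.
  by rewrite !big_ord0 addn0 add0r subrr.
rewrite !big_ord_recr /= IH ?addnS //; last by lia.
have cell : col_cross (i + k) j + row_cross (i + k) j.+1 =
            row_cross (i + k) j + col_cross (i + k).+1 j.
  by apply: cross_cell; rewrite eq_sym; apply: simple; lia.
move: cell; lra.
Qed.

(** Replaces the tangents along the first steps of the path by the secants from
its first point, followed by the secants to the last point reached. *)
Lemma triangle_cross m : (m.+1 < N)%N ->
  \sum_(i < m) (col_cross i i.+1 + row_cross i i.+2) =
  \sum_(i < m) col_cross 0 i.+1 + \sum_(i < m) row_cross i m.+1.
Proof.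
elim: m => [|m IH] mN; first by rewrite !big_ord0.
have row : \sum_(i < m) row_cross i m.+2 =
  \sum_(i < m) row_cross i m.+1 + col_cross m m.+1 - col_cross 0 m.+1.
  by apply: (@row_cross_telescope 0 m m.+1); lia.
rewrite 3!big_ord_recr /= IH ?row; last by lia.
lra.
Qed.

(** With N the period and the path starting at its lowest point, the secants from
the start stay above the ray and those to the start stay below it.  The secant
from point 0 to point N vanishes, so the deformation must go around it, from
the pair (0, N - 1) over (1, N - 1) to (1, N); only this detour and the last
tangents can cross the ray. *)
Lemma total_turn_from_bottom :
  (0 < N)%N -> (forall j, (0 < j)%N -> (j < N)%N -> upper (midpoint j)) ->
  `|\sum_(i < N) quarter_turn i| = 4.
Proof.
move=> N_gt0 bottom; rewrite total_turn_cross.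
have m0 : midpoint 0 = 0 by rewrite /midpoint big_ord0.
have m1 : midpoint 1 = corner_step 0 by rewrite midpointS m0 add0r.
have m2 : midpoint 2 = corner_step 0 + corner_step 1 by rewrite midpointS m1.
have n1 : midpoint 1 != 0.
  by rewrite m1; case: (diagonalE (corner_step_diagonal 0)) => ->.
have n2 : midpoint 2 != 0.
  rewrite m2 /corner_step.
  by case: (d_turn 1) => ->; case: (d_turn 0) => ->; move: (d 0); apply: dir_ind.
have N1 : N <> 1%N by move=> E; rewrite -E closed eqxx in n1.
have N2 : N <> 2%N by move=> E; rewrite -E closed eqxx in n2.
have [M NE] : exists M, N = M.+3 by exists (N - 3)%N; lia.
have last_step : midpoint M.+2 = - corner_step M.+2.
  by apply/eqP; rewrite -addr_eq0 -midpointS -NE closed.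
have row : \sum_(m < M) row_cross m.+1 M.+3 =
  \sum_(m < M) row_cross m.+1 M.+2 + col_cross M.+1 M.+2 - col_cross 1 M.+2.
  by apply: (@row_cross_telescope 1 M M.+2); lia.
have cols : \sum_(j < M.+1) col_cross 0 j.+1 = 0.
  apply: big1 => j _; rewrite /col_cross m0 !subr0.
  by apply: ray_cross_upper; apply: bottom; have := ltn_ord j; lia.
(* The secants that end at the start of the path, point N = M + 3. *)
have rows : \sum_(m < M) row_cross m.+1 M.+3 + row_cross M.+1 M.+3 = 0.
  transitivity (\sum_(m < M.+1) row_cross m.+1 M.+3); first by rewrite big_ord_recr.
  apply: big1 => m _; rewrite /row_cross -NE closed !sub0r.
  by apply: ray_cross_lower; apply: bottom; have := ltn_ord m; lia.
(* The four crossings not yet accounted for, written as in ray_cross_bottom. *)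
have cC : col_cross 1 M.+2 = ray_cross (- corner_step M.+2 - corner_step 0) (- corner_step 0).
  by rewrite /col_cross -NE closed last_step m1 sub0r.
have cR : row_cross 0 M.+2 = ray_cross (- corner_step M.+2) (- corner_step M.+2 - corner_step 0).
  by rewrite /row_cross last_step m1 m0 subr0.
have mN1 : midpoint N.+1 = corner_step 0.
  by rewrite midpointS closed add0r -[N in LHS]add0n corner_step_periodic.
have cE : col_cross M.+2 M.+3 = ray_cross (corner_step M.+2) (corner_step M.+2 + corner_step 0).
  by rewrite /col_cross -NE mN1 closed last_step opprK add0r addrC.
have rE : row_cross M.+2 M.+4 = ray_cross (corner_step M.+2 + corner_step 0) (corner_step 0).
  by rewrite /row_cross -NE mN1 closed last_step opprK subr0 addrC.
have -> : \sum_(i < N) (col_cross i i.+1 + row_cross i i.+2) =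
    row_cross 0 M.+2 + col_cross 1 M.+2 +
    (col_cross M.+2 M.+3 + row_cross M.+2 M.+4).
  rewrite NE 2!big_ord_recr /= triangle_cross ?NE // cols add0r.
  have -> : \sum_(i < M.+1) row_cross i M.+2 =
      row_cross 0 M.+2 + \sum_(i < M) row_cross i.+1 M.+2.
    by rewrite big_ord_recl; congr (_ + _); apply: eq_bigr => i _; rewrite lift0.
  move: row rows; lra.
have s_s : corner_step 0 + corner_step M.+2 != 0.
  rewrite -m1 -subr_eq0 addr0 -[corner_step M.+2]opprK -last_step subr_eq0.
  by apply: simple; lia.
rewrite cC cR cE rE normrM ray_cross_bottom ?corner_step_diagonal //.
  by rewrite -m1; apply: bottom; lia.
by rewrite -last_step; apply: bottom; lia.
Qed.

End Closed.
End Periodic.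
End TurningPath.

Lemma midpoint_shift (d : nat -> dir) m i :
  midpoint (fun j => d (m + j)%N) i = midpoint d (m + i) - midpoint d m.
Proof.
elim: i => [|i IH]; first by rewrite /midpoint big_ord0 addn0 subrr.
by rewrite midpointS IH addnS midpointS /corner_step addnS addrAC.
Qed.

(** A closed path may be started at the leftmost one of its lowest points, which
is where total_turn_from_bottom applies. *)
Lemma total_turn_contractible (d : nat -> dir) N :
  (forall i, d i.+1 = d i + 1 \/ d i.+1 = d i - 1) ->
  (forall i, d (i + N)%N = d i) -> (0 < N)%N -> midpoint d N = 0 ->
  (forall i j, (i < j)%N -> (j < i + N)%N -> midpoint d i != midpoint d j) ->
  `|\sum_(i < N) quarter_turn d i| = 4.
Proof.
move=> d_turn d_per N_gt0 closed simple.
have mid_per i : midpoint d (i + N) = midpoint d i.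
  by rewrite midpoint_periodic // closed addr0.
have mid_mod i : midpoint d i = midpoint d (i %% N).
  rewrite {1}(divn_eq i N); elim: (i %/ N)%N => [|q IH]; first by rewrite add0n.
  by rewrite mulSn -addnA addnC mid_per.
pose X i := (midpoint d i).1; pose Y i := (midpoint d i).2.
pose O0 := Ordinal N_gt0.
have [iy _ iyP] := @arg_minP _ _ _ O0 xpredT (fun i : 'I_N => Y i) isT.
have [m /= /eqP mY mP] := @arg_minP _ _ _ iy (fun i : 'I_N => Y i == Y iy)
  (fun i : 'I_N => X i) (eqxx _).
have t_per i : quarter_turn d (i + N) = quarter_turn d i.
  by rewrite /quarter_turn -addSn !d_per.
rewrite -(sum_shift_periodic m t_per).
have -> : \sum_(i < N) quarter_turn d (m + i) =
    \sum_(i < N) quarter_turn (fun j => d (m + j)%N) i.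
  by apply: eq_bigr => i _; rewrite /quarter_turn addnS.
have shift_mid := midpoint_shift d m.
apply: total_turn_from_bottom => //.
- by move=> i; rewrite addnS.
- by move=> i; rewrite addnA.
- by rewrite shift_mid mid_per subrr.
- move=> i j ij jN; rewrite !shift_mid (inj_eq (addIr _)).
  by apply: simple; lia.
move=> j j0 jN; rewrite shift_mid.
have ne : midpoint d m != midpoint d (m + j) by apply: simple; lia.
have jm : ((m + j) %% N < N)%N by rewrite ltn_mod.
have := iyP (Ordinal jm) isT; have := mP (Ordinal jm).
rewrite /X /Y /= -mid_mod; move: ne mY; rewrite /Y.
case: (midpoint d m) => x y; case: (midpoint d (m + j)) => x' y'.
by rewrite -pair_eqE /pair_eq /upper /=; lia.
Qed.

(** * Homotopy of lattice words *)

Definition displacement (w : seq dir) : int * int := \sum_(d <- w) unit_vec d.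

Lemma dir_oppK : involutive (fun d : dir => d + 2).
Proof. by move=> d; move: d; apply: dir_ind; apply: val_inj. Qed.

Lemma dir_opp_neq (d : dir) : d + 2 != d.
Proof. by move: d; apply: dir_ind. Qed.

Lemma unit_vec_opp d : unit_vec (d + 2) = - unit_vec d.
Proof. by move: d; apply: dir_ind. Qed.

Lemma homotopic_displacement w w' :
  homotopic w w' -> displacement w = displacement w'.
Proof.
elim=> {w w'} [_ _ [p q d|p q d]|//|_ _ _ ->//|_ _ _ _ -> _ ->//].
  by rewrite /displacement !big_cat /= !big_cons big_nil unit_vec_opp addr0 subrr add0r.
rewrite /displacement !big_cat /= !big_cons big_nil (_ : d + 3 = d + 1 + 2).
  by rewrite !unit_vec_opp addr0 [X in _ + (X + _)]addrA -opprD subrr add0r.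
by rewrite -addrA.
Qed.

(** Two perpendicular steps commute because the boundary of a face is trivial:
e (e+1) is e (e+1) (e+2) e, then e (e+1) (e+2) (e+3) (e+1) e, and the first
four letters bound a face. *)
Lemma homotopic_swap p q d d' :
  homotopic (p ++ [:: d, d' & q]) (p ++ [:: d', d & q]).
Proof.
have swap1 e : homotopic (p ++ [:: e, e + 1 & q]) (p ++ [:: e + 1, e & q]).
  apply: (@rst_trans _ _ _ (p ++ [:: e; e + 1; e + 2; e] ++ q)).
    have := backtrack (p ++ [:: e; e + 1]) q (e + 2).
    rewrite dir_oppK -!catA; exact: rst_step.
  apply: (@rst_trans _ _ _ (p ++ [:: e; e + 1; e + 2; e + 3; e + 1; e] ++ q)).
    have := backtrack (p ++ [:: e; e + 1; e + 2]) (e :: q) (e + 3).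
    rewrite (_ : e + 3 + 2 = e + 1) -?catA; first exact: rst_step.
    by move: e; apply: dir_ind; apply: val_inj.
  apply: rst_sym; apply: rst_step.
  exact: (around_face p ([:: e + 1; e] ++ q) e).
have: [\/ d' = d, d' = d + 1, d' = d + 2 | d = d' + 1].
  by move: d'; apply: dir_ind; move: d; apply: dir_ind;
    by [constructor 1; apply: val_inj|constructor 2; apply: val_inj|
        constructor 3; apply: val_inj|constructor 4; apply: val_inj].
case=> ->; [exact: rst_refl|exact: swap1| |by apply: rst_sym; exact: swap1].
apply: (@rst_trans _ _ _ (p ++ q)).
  by apply: rst_sym; apply: rst_step; exact: (backtrack p q d).
apply: rst_step; have := backtrack p q (d + 2).
by rewrite dir_oppK.
Qed.

Lemma homotopic_to_front p q d r :
  homotopic (r ++ p ++ d :: q) (r ++ d :: p ++ q).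
Proof.
elim: p r => [|x p IH] r; first exact: rst_refl.
apply: (@rst_trans _ _ _ (r ++ [:: x, d & p ++ q])).
  by have := IH (r ++ [:: x]); rewrite -!catA.
exact: homotopic_swap.
Qed.

Lemma displacement_count w : displacement w =
  ((count_mem 0 w)%:Z - (count_mem 2 w)%:Z, (count_mem 1 w)%:Z - (count_mem 3 w)%:Z).
Proof.
rewrite /displacement; elim: w => [|d w IH]; first by rewrite big_nil.
rewrite big_cons IH; move: d; apply: dir_ind; apply: pairE => /=; lia.
Qed.

Lemma displacement0_count w d :
  displacement w = 0 -> count_mem d w = count_mem (d + 2) w.
Proof.
rewrite displacement_count => w0; pose c (e : dir) := count_mem e w.
have c02 : c 0 = c 2 by case: w0; rewrite -/(c 0) -/(c 2); lia.
have c13 : c 1 = c 3 by case: w0; rewrite -/(c 1) -/(c 3); lia.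
suff: c d = c (d + 2) by [].
move: d; apply: dir_ind.
- by rewrite c02; congr c; apply: val_inj.
- by rewrite c13; congr c; apply: val_inj.
- by rewrite -c02; congr c; apply: val_inj.
- by rewrite -c13; congr c; apply: val_inj.
Qed.

(** The fundamental group of the torus is free abelian of rank 2: as all steps
commute, a word without displacement cancels against itself. *)
Lemma homotopic_nil w : homotopic w [::] <-> displacement w = 0.
Proof.
split=> [/homotopic_displacement ->|]; first by rewrite /displacement big_nil.
have [m] := ubnP (size w); elim: m w => // m IH [_ _|d w sw w0]; first exact: rst_refl.
have dw : d + 2 \in w.
  suff: d + 2 \in d :: w by rewrite in_cons (negPf (dir_opp_neq d)).
  by rewrite -has_pred1 has_count -(displacement0_count _ w0) -has_count has_pred1 mem_head.
case/splitPr: dw sw w0 => p q sw w0.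
have E : homotopic (d :: p ++ d + 2 :: q) (p ++ q).
  apply: (@rst_trans _ _ _ ([:: d; d + 2] ++ p ++ q)).
    exact: (homotopic_to_front p q (d + 2) [:: d]).
  by apply: rst_sym; apply: rst_step; exact: (backtrack [::] (p ++ q) d).
apply: (@rst_trans _ _ _ (p ++ q)) => //; apply: IH.
  by move: sw; rewrite /= !size_cat /=; lia.
by rewrite -(homotopic_displacement E).
Qed.

(** * Unrolling a loop of the torus *)

Lemma unit_vec_left d : unit_vec (d + 1) = (- (unit_vec d).2, (unit_vec d).1).
Proof. by move: d; apply: dir_ind. Qed.

Lemma unit_vec_right d : unit_vec (d - 1) = ((unit_vec d).2, - (unit_vec d).1).
Proof. by move: d; apply: dir_ind. Qed.

Lemma unit_vec_norm d : `|(unit_vec d).1| + `|(unit_vec d).2| = 1.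
Proof. by move: d; apply: dir_ind. Qed.

Section LoopsOnTorus.
Variables n j1 j2 : nat.
Implicit Types (e f : dart n j1 j2) (p : int * int) (d : dir) (b : bool).

Definition to_torus p : vertex n j1 j2 := (p.1%:~R, p.2%:~R).

Lemma to_torusD p q : to_torus (p + q) = to_torus p + to_torus q.
Proof. by rewrite /to_torus /= !rmorphD. Qed.

Lemma to_torus_unit d : to_torus (unit_vec d) = dvec n j1 j2 d.
Proof. by move: d; apply: dir_ind. Qed.

Lemma dvec_opp d : dvec n j1 j2 (d + 2) = - dvec n j1 j2 d.
Proof.
rewrite -!to_torus_unit unit_vec_opp /to_torus /=.
by rewrite !rmorphN.
Qed.

Lemma head_rev_dart e : dart_head (rev_dart e) = e.1.
Proof. by rewrite /dart_head /= dvec_opp addrK. Qed.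

Lemma rev_dartK : involutive (@rev_dart n j1 j2).
Proof. by case=> v d; rewrite /rev_dart head_rev_dart /= dir_oppK. Qed.

Lemma rev_dart_neq e : rev_dart e != e.
Proof. by rewrite -pair_eqE /= negb_and (dir_opp_neq e.2) orbT. Qed.

Lemma partnerK b : involutive (partner b).
Proof. by case: b; apply: dir_ind; apply: val_inj. Qed.

Lemma partner_neq b d : partner b d != d.
Proof. by case: b; move: d; apply: dir_ind. Qed.

Lemma partner_opp b d :
  partner b (d + 2) = d + 1 \/ partner b (d + 2) = d - 1.
Proof.
by case: b; move: d; apply: dir_ind; (left; by apply: val_inj) || (right; by apply: val_inj).
Qed.

Section Loop.
Variable L : loop_config n j1 j2.

Lemma next_rev_dart e :
  next_dart L (rev_dart e) = (e.1, partner (L e.1) e.2).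
Proof. by rewrite /next_dart head_rev_dart /= dir_oppK. Qed.

(** Reversing an oriented loop gives an oriented loop. *)
Lemma next_rev_next e : next_dart L (rev_dart (next_dart L e)) = rev_dart e.
Proof. by rewrite next_rev_dart partnerK. Qed.

Lemma next_dart_inj : injective (next_dart L).
Proof.
apply: (can_inj (g := fun e => rev_dart (next_dart L (rev_dart e)))) => e.
by rewrite next_rev_next rev_dartK.
Qed.

Lemma iter_next_inj m : injective (iter m (next_dart L)).
Proof. by elim: m => // m IH x y /= /next_dart_inj /IH. Qed.

Lemma iter_next_rev m e :
  iter m (next_dart L) (rev_dart (iter m (next_dart L) e)) = rev_dart e.
Proof. by elim: m => // m IH; rewrite iterSr iterS next_rev_next. Qed.

(** If a loop ran back along itself, walking from both ends would meet in the
middle: either in an edge equal to its reversal, or in a turn that returns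
along the same edge. *)
Lemma iter_next_neq_rev m e : iter m (next_dart L) e != rev_dart e.
Proof.
apply/eqP; rewrite -(odd_double_half m) -addnn.
rewrite -(iter_next_rev (m./2) e) addnCA iterD => /iter_next_inj.
case: (odd m) => /=; last by move/eqP; rewrite eq_sym (negPf (rev_dart_neq _)).
move: (iter _ _ _) => x /(congr1 snd)/= /eqP.
by rewrite (negPf (partner_neq _ _)).
Qed.

(** The loop read as an infinite word of directions, and its vertices in the
universal cover, starting from the origin. *)
Definition walk e i : dir := (iter i (next_dart L) e).2.

Definition unrolled e i : int * int := \sum_(m < i) unit_vec (walk e m).

Lemma walk_turn e i : walk e i.+1 = walk e i + 1 \/ walk e i.+1 = walk e i - 1.
Proof. exact: partner_opp. Qed.

Lemma iter_next_vertex e i :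
  (iter i (next_dart L) e).1 = e.1 + to_torus (unrolled e i).
Proof.
elim: i => [|i IH]; first by rewrite /unrolled big_ord0 addr0.
rewrite /unrolled big_ord_recr to_torusD to_torus_unit addrA -[X in X + _]IH.
by [].
Qed.

Lemma midpoint_unrolled e i : midpoint (walk e) i + unit_vec e.2 =
  unrolled e i + unrolled e i + unit_vec (walk e i).
Proof.
elim: i => [|i IH]; first by rewrite /midpoint /unrolled !big_ord0 !add0r.
rewrite midpointS addrAC IH /corner_step /unrolled !big_ord_recr /= -/(unrolled e i).
by rewrite [in RHS]addrACA !addrA.
Qed.

(** Midpoints of edges determine the edges: mod 2 they tell horizontal from
vertical edges. *)
Lemma unit_vec_parity d d' p p' :
  p + p + unit_vec d = p' + p' + unit_vec d' ->
  d = d' /\ p = p' \/ d' = d + 2 /\ p' = p + unit_vec d.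
Proof.
have [] : [\/ d' = d, d' = d + 1, d' = d + 2 | d' = d - 1].
  by move: d'; apply: dir_ind; move: d; apply: dir_ind;
    by [constructor 1; apply: val_inj|constructor 2; apply: val_inj|
        constructor 3; apply: val_inj|constructor 4; apply: val_inj].
all: move=> ->; rewrite ?unit_vec_opp ?unit_vec_left ?unit_vec_right.
all: have := unit_vec_norm d; case: (unit_vec d) p p' => [a c] [x y] [x' y'] /=.
- by move=> _ [ex ey]; left; split=> //; apply: pairE; lia.
- by move=> u [ex ey]; lia.
- move=> u [ex ey]; right; split=> //.
  by apply: pairE => /=; lia.
- by move=> u [ex ey]; lia.
Qed.

(** An unrolled loop passes through each midpoint once, unless it closes up: a
second passage would be along the same edge of the torus, and not in the
opposite direction. *)
Lemma midpoint_walk_inj e i j :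
  midpoint (walk e) i = midpoint (walk e) j ->
  iter i (next_dart L) e = iter j (next_dart L) e /\ unrolled e i = unrolled e j.
Proof.
wlog ij : i j / (i <= j)%N.
  move=> H; case/orP: (leq_total i j) => [/H//|/H + E].
  by move=> /(_ (esym E))[-> ->].
move=> E; have : unrolled e i + unrolled e i + unit_vec (walk e i) =
                 unrolled e j + unrolled e j + unit_vec (walk e j).
  by rewrite -!midpoint_unrolled E.
case/unit_vec_parity => -[dd pp].
  split=> //; rewrite [LHS]surjective_pairing [RHS]surjective_pairing.
  by rewrite !iter_next_vertex pp; congr (_, _); exact: dd.
have /eqP[] := iter_next_neq_rev (j - i) (iter i (next_dart L) e).
rewrite -iterD subnK // [LHS]surjective_pairing iter_next_vertex pp.
by rewrite /rev_dart /dart_head iter_next_vertex to_torusD to_torus_unit addrA;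
  congr (_, _); exact: dd.
Qed.

Definition period e : nat := order (next_dart L) e.

Lemma iter_next_period e i : iter (i + period e) (next_dart L) e = iter i (next_dart L) e.
Proof. by rewrite iterD (iter_order next_dart_inj). Qed.

Lemma walk_periodic e i : walk e (i + period e) = walk e i.
Proof. by rewrite /walk iter_next_period. Qed.

Lemma unrolled_periodic e q i : unrolled e (i + q * period e) = unrolled e i + unrolled e (period e) *+ q.
Proof.
have lift1 m : unrolled e (m + period e) = unrolled e m + unrolled e (period e).
  elim: m => [|m IH]; first by rewrite {2}/unrolled big_ord0 add0r.
  by rewrite addSn /unrolled !big_ord_recr /= -!/(unrolled _ _) IH walk_periodic addrAC.
elim: q => [|q IH]; first by rewrite addn0 addr0.
by rewrite mulSn [(period e + _)%N]addnC addnA lift1 IH mulrSr addrA.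
Qed.

Lemma iter_next_eq e i j : (i < j)%N ->
  iter i (next_dart L) e = iter j (next_dart L) e ->
  exists2 q, (0 < q)%N & j = (i + q * period e)%N.
Proof.
move=> ij; rewrite -{1}(subnK (ltnW ij)) addnC iterD => /iter_next_inj.
set r := (j - i)%N => er.
have ord0 : (0 < period e)%N by apply: order_gt0.
have emod m : iter m (next_dart L) e = iter (m %% period e) (next_dart L) e.
  rewrite {1}(divn_eq m (period e)); elim: (m %/ _)%N => [|q IH]; first by rewrite add0n.
  by rewrite mulSn -addnA addnC iter_next_period.
have r0 : (r %% period e = 0)%N.
  have rlt : (r %% period e < period e)%N by rewrite ltn_mod.
  by rewrite -(findex_iter rlt) -emod -er findex0.
exists (r %/ period e)%N; last first.
  by have := divn_eq r (period e); rewrite r0 addn0 /r => <-; lia.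
by rewrite divn_gt0 // dvdn_leq //; [rewrite /r; lia|apply/eqP].
Qed.

Lemma midpoint_period e :
  midpoint (walk e) (period e) = unrolled e (period e) + unrolled e (period e).
Proof.
apply: (addIr (unit_vec e.2)); rewrite midpoint_unrolled.
by have := walk_periodic e 0; rewrite add0n => ->.
Qed.

(** The Umlaufsatz for the loops of the torus. *)
Lemma total_turn_loop e :
  `|\sum_(i < period e) quarter_turn (walk e) i| =
  if unrolled e (period e) == 0 then 4 else 0.
Proof.
have ord0 : (0 < period e)%N by apply: order_gt0.
case: eqVneq => [l0|lN0].
  apply: total_turn_contractible => //.
  - exact: walk_turn.
  - exact: walk_periodic.
  - by rewrite midpoint_period l0 addr0.
  move=> i j ij jN; apply/eqP => /midpoint_walk_inj[/(iter_next_eq ij)[q q0 jE] _].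
  by move: jN; rewrite jE ltn_add2l ltnNge leq_pmull.
rewrite total_turn_noncontractible ?normr0 //.
- exact: walk_turn.
- exact: walk_periodic.
- rewrite midpoint_period; apply: contraNneq lN0.
  case: (unrolled e _) => x y [xx yy]; apply/eqP; apply: pairE; lia.
move=> i j ij; apply/eqP => /midpoint_walk_inj[/(iter_next_eq ij)[q q0 ->]].
rewrite unrolled_periodic => /esym/eqP; rewrite -subr_eq0 addrAC subrr add0r.
have E (v : int * int) k : v *+ k = (v.1 *+ k, v.2 *+ k).
  by elim: k => [|k IH]; rewrite ?mulr0n // !mulrS IH.
apply/negP; move: lN0; apply: contraNN; case: (unrolled e (period e)) => x y.
rewrite E => /eqP[/eqP + /eqP +]; rewrite /= !mulrn_eq0.
by rewrite !(gtn_eqF q0) /= => /eqP-> /eqP->.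
Qed.

End Loop.
End LoopsOnTorus.

Local Open Scope complex_scope.

(** * Winding and weight of a loop *)

Section Loops.
Variables n j1 j2 : nat.
Variable L : loop_config n j1 j2.
Implicit Types (e f x : dart n j1 j2) (A O : {set dart n j1 j2}).
Local Notation next := (next_dart L).

Definition oriented_loop e : {set dart n j1 j2} := [set f in orbit next e].

Lemma mem_oriented_loop e f : (f \in oriented_loop e) = fconnect next e f.
Proof. by rewrite inE -fconnect_orbit. Qed.

Lemma oriented_loop_eq e f : f \in oriented_loop e -> oriented_loop f = oriented_loop e.
Proof.
rewrite mem_oriented_loop => ef; apply/setP => x; rewrite !mem_oriented_loop.
by rewrite (same_connect (fconnect_sym (@next_dart_inj _ _ _ L)) ef).
Qed.

Lemma oriented_loop_self e : e \in oriented_loop e.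
Proof. by rewrite mem_oriented_loop. Qed.

Lemma oriented_loop_next e : oriented_loop (next e) = oriented_loop e.
Proof. by apply: oriented_loop_eq; rewrite mem_oriented_loop fconnect1. Qed.

Lemma mem_oriented_loop_iter e f :
  f \in oriented_loop e -> exists i, f = iter i next e.
Proof.
by rewrite mem_oriented_loop => /iter_findex <-; exists (findex next e f).
Qed.

Lemma oriented_loop_rev_next x : oriented_loop (rev_dart (next x)) = oriented_loop (rev_dart x).
Proof. by rewrite -[in RHS](next_rev_next L) oriented_loop_next. Qed.

Lemma oriented_loop_rev e f :
  (f \in oriented_loop (rev_dart e)) = (rev_dart f \in oriented_loop e).
Proof.
have H x y : y \in oriented_loop x -> rev_dart y \in oriented_loop (rev_dart x).
  case/mem_oriented_loop_iter => i ->; elim: i => [|i IH]; first exact: oriented_loop_self.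
  by rewrite -(oriented_loop_eq IH) -oriented_loop_rev_next iterS oriented_loop_self.
by apply/idP/idP => /H; rewrite rev_dartK.
Qed.

Lemma rev_darts_mem A f : (f \in rev_darts A) = (rev_dart f \in A).
Proof.
apply/imsetP/idP => [[e eA ->]|fA]; first by rewrite rev_dartK.
by exists (rev_dart f); rewrite ?rev_dartK.
Qed.

Lemma rev_darts_loop e : rev_darts (oriented_loop e) = oriented_loop (rev_dart e).
Proof. by apply/setP => f; rewrite rev_darts_mem oriented_loop_rev. Qed.

Lemma rev_notin_loop e : rev_dart e \notin oriented_loop e.
Proof.
apply/negP => /mem_oriented_loop_iter[i /esym/eqP].
by rewrite (negPf (iter_next_neq_rev _ _ _)).
Qed.

Lemma oriented_loop_rev_neq e : oriented_loop (rev_dart e) != oriented_loop e.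
Proof.
by apply: contraNneq (rev_notin_loop e) => <-; exact: oriented_loop_self.
Qed.

(** The unoriented loop that contains the edge x: its two orientations. *)
Definition loop_through x : {set {set dart n j1 j2}} :=
  [set oriented_loop x; oriented_loop (rev_dart x)].

Lemma loop_through_rev x : loop_through (rev_dart x) = loop_through x.
Proof. by rewrite /loop_through rev_dartK setUC. Qed.

Lemma loop_through_next x : loop_through (next x) = loop_through x.
Proof. by rewrite /loop_through oriented_loop_next oriented_loop_rev_next. Qed.

Lemma loop_through_eq O x e :
  O \in loop_through e -> x \in O -> loop_through x = loop_through e.
Proof.
rewrite /loop_through !inE => /orP[] /eqP-> xe.
  rewrite (oriented_loop_eq xe) (@oriented_loop_eq (rev_dart e) (rev_dart x)) //.
  by rewrite oriented_loop_rev rev_dartK.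
rewrite (oriented_loop_eq xe) (@oriented_loop_eq e (rev_dart x)) 1?setUC //.
by rewrite -oriented_loop_rev.
Qed.

Lemma loopsP l : reflect (exists e, l = loop_through e) (l \in loops L).
Proof.
apply: (iffP imsetP) => [[O /imsetP[e _ ->] ->]|[e ->]].
  by exists e; rewrite rev_darts_loop.
exists (oriented_loop e); last by rewrite rev_darts_loop.
by apply/imsetP; exists e.
Qed.

Lemma sum_loop_through (T : nmodType) (F : {set dart n j1 j2} -> T) e :
  \sum_(O in loop_through e) F O =
  F (oriented_loop e) + F (oriented_loop (rev_dart e)).
Proof. by rewrite big_setU1 ?inE 1?eq_sym ?oriented_loop_rev_neq //= big_set1. Qed.

Lemma sum_oriented_loop (T : nmodType) (F : dart n j1 j2 -> T) e :
  \sum_(f in oriented_loop e) F f = \sum_(i < period L e) F (iter i next e).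
Proof.
transitivity (\sum_(f in orbit next e) F f); first by apply: eq_bigl => f; rewrite inE.
rewrite -(big_uniq _ (orbit_uniq _ _)) /orbit /= -/(period L e).
rewrite (_ : traject next e (period L e) = [seq iter i next e | i <- iota 0 (period L e)]).
  by rewrite big_map -{1}[period L e]subn0 big_mkord.
apply: (@eq_from_nth _ e) => [|i]; rewrite size_traject ?size_map ?size_iota // => iN.
by rewrite nth_traject // (nth_map 0) ?size_iota // nth_iota.
Qed.

(** An involution exchanging the two orientations that turns each turn into
the reversed one: the edge entering it becomes the reversal of the edge that
leaves it. *)
Lemma sum_reversed_loop (T : nmodType) (F : dart n j1 j2 -> T) e :
  \sum_(f in oriented_loop (rev_dart e)) F f =
  \sum_(f in oriented_loop e) F (rev_dart (next f)).
Proof.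
have hK : involutive (fun x => rev_dart (next x)).
  by move=> x /=; rewrite next_rev_next rev_dartK.
rewrite (reindex_inj (inv_inj hK)); apply: eq_bigl => f.
rewrite oriented_loop_rev rev_dartK !mem_oriented_loop.
by rewrite (same_connect_r (fconnect_sym (@next_dart_inj _ _ _ L)) (fconnect1 next f)).
Qed.

Definition turn_sign e : int := if (next e).2 == e.2 + 1 then 1 else -1.

Lemma turn_sign_rev_next e : turn_sign (rev_dart (next e)) = - turn_sign e.
Proof.
rewrite /turn_sign next_rev_next /=; case: (walk_turn L e 0); rewrite /walk /= => ->.
all: by move: e.2; apply: dir_ind.
Qed.

Lemma winding_sum (R : realType) O :
  winding R L O = (\sum_(f in O) turn_sign f)%:~R / 4.
Proof.
rewrite /winding; congr (_ / 4).
rewrite -!sum1dep_card !natr_sum rmorph_sum /=.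
rewrite [X in X - _](eq_bigl (fun f => (f \in O) && ((next f).2 == f.2 + 1))) //.
rewrite [X in _ - X](eq_bigl (fun f => (f \in O) && ((next f).2 == f.2 - 1))) //.
rewrite !big_mkcondr -sumrB; apply: eq_bigr => f _; rewrite /turn_sign.
case: (walk_turn L f 0); rewrite /walk /= => ->.
  rewrite eqxx (_ : (_ == _) = false) ?subr0 //.
  by move: f.2; apply: dir_ind.
rewrite eqxx (_ : (_ == _) = false) ?sub0r //.
by move: f.2; apply: dir_ind.
Qed.

Lemma winding_rev (R : realType) e :
  winding R L (oriented_loop (rev_dart e)) = - winding R L (oriented_loop e).
Proof.
rewrite !winding_sum sum_reversed_loop -mulNr -rmorphN -sumrN; congr (_%:~R / 4).
by apply: eq_bigr => f _; rewrite turn_sign_rev_next.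
Qed.

Lemma displacement_loop e :
  displacement [seq f.2 | f <- orbit next e] = \sum_(f in oriented_loop e) unit_vec f.2.
Proof.
rewrite /displacement big_map big_uniq ?orbit_uniq //.
by apply: eq_bigl => f; rewrite inE.
Qed.

(** The displacement depends neither on the starting point of the loop nor, up to
sign, on its orientation, so one choice decides. *)
Lemma contractibleP e :
  contractible L (loop_through e) <-> unrolled L e (period L e) = 0.
Proof.
have -> : unrolled L e (period L e) = \sum_(f in oriented_loop e) unit_vec f.2.
  by rewrite sum_oriented_loop.
split=> [[O Oe [x xO /homotopic_nil]]|e0]; last first.
  exists (oriented_loop e); first by rewrite !inE eqxx.
  exists e; first exact: oriented_loop_self.
  by apply/homotopic_nil; rewrite displacement_loop.
rewrite displacement_loop; move: Oe xO; rewrite !inE => /orP[] /eqP-> xO.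
  by rewrite (oriented_loop_eq xO).
rewrite (oriented_loop_eq xO) (reindex_inj (inv_inj (@rev_dartK n j1 j2))) /=.
under eq_bigl do rewrite oriented_loop_rev rev_dartK.
under eq_bigr do rewrite unit_vec_opp.
by rewrite sumrN => /eqP; rewrite oppr_eq0 => /eqP.
Qed.

Lemma winding_loop (R : realType) e :
  `|winding R L (oriented_loop e)| = if `[< contractible L (loop_through e) >] then 1 else 0.
Proof.
have -> : `[< contractible L (loop_through e) >] = (unrolled L e (period L e) == 0).
  by apply/asboolP/eqP => /contractibleP.
rewrite winding_sum sum_oriented_loop normrM -intr_norm.
rewrite (_ : \sum_(i < _) _ = \sum_(i < period L e) quarter_turn (walk L e) i) //.
rewrite total_turn_loop normfV normr_nat; case: ifP => _; last by rewrite mul0r.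
by rewrite (_ : 4%:~R = 4%:R) // divff ?pnatr_eq0.
Qed.

Lemma expi_addN (R : realType) (x : R) : expi x + expi (- x) = (2 * cos x)%:C.
Proof.
by rewrite /expi cosN sinN; apply/eqP; rewrite eq_complex /= subrr eqxx andbT mulr2n mulrDl mul1r.
Qed.

(** The two orientations have opposite windings w, hence total phase
2 cos(lam w); the sign of w does not matter. *)
Lemma sum_expi_winding (R : realType) (lam : R) e :
  \sum_(O in loop_through e) expi (lam * winding R L O) =
  (if `[< contractible L (loop_through e) >] then 2 * cos lam else 2)%:C.
Proof.
rewrite sum_loop_through winding_rev mulrN expi_addN; congr _%:C.
have := winding_loop R e; case: ifP => _.
  by case: (ger0P (winding _ _ _)) => [_ ->|_ /eqP];
    rewrite ?mulr1 // eqr_oppLR => /eqP ->; rewrite mulrN1 cosN.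
by move/eqP; rewrite normr_eq0 => /eqP->; rewrite mulr0 cos0 mulr1.
Qed.

Lemma loop_weight_prod (R : realType) (c lam : R) :
  Num.sqrt (qpar c) = 2 * cos lam -> cos lam != 0 ->
  (loop_weight c L)%:C =
  \prod_(l in loops L) \sum_(O in l) expi (lam * winding R L O).
Proof.
move=> q_lam cos0; rewrite /loop_weight q_lam.
have noncontrE (x : R) : x ^+ #|noncontractible_loops L| =
    \prod_(l in loops L) (if ~~ `[< contractible L l >] then x else 1).
  by rewrite -prodr_const -big_mkcondr; apply: eq_bigl => l; rewrite inE.
rewrite noncontrE -prodr_const -big_split rmorph_prod.
apply: eq_bigr => _ /loopsP[e ->] /=.
rewrite sum_expi_winding; case: `[< _ >] => /=; first by rewrite mulr1.
by congr _%:C; rewrite mulrCA mulfV ?mulr1 // mulf_neq0 // pnatr_eq0.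
Qed.
End Loops.

(** * Orientations of a loop configuration *)

Section Expansion.
Variables n j1 j2 : nat.
Implicit Types (e f x : dart n j1 j2) (A O : {set dart n j1 j2}).
Implicit Types (L : loop_config n j1 j2).

(** The arrows of A run along the loops of L. *)
Definition follows L A : bool :=
  orientation A && [forall e, (next_dart L e \in A) == (e \in A)].

Lemma orientation_rev A x : orientation A -> (rev_dart x \in A) = (x \notin A).
Proof. by move=> /forallP/(_ x); case: (x \in A); case: (_ \in A). Qed.

Lemma follows_loop L A e f :
  follows L A -> f \in oriented_loop L e -> (f \in A) = (e \in A).
Proof.
case/andP=> _ /forallP clA /mem_oriented_loop_iter[i ->].
by elim: i => //= i <-; apply/eqP.
Qed.

Definition orient L A (l : {set {set dart n j1 j2}}) : {set dart n j1 j2} :=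
  [set x in A | loop_through L x == l].

Lemma orient_mem L A e : follows L A ->
  orient L A (loop_through L e) \in loop_through L e.
Proof.
move=> fA; wlog eA : e / e \in A.
  move=> H; have [/H//|eA] := boolP (e \in A).
  by rewrite -loop_through_rev H // orientation_rev //; case/andP: fA.
rewrite (_ : orient _ _ _ = oriented_loop L e) ?inE ?eqxx //.
apply/setP => x; rewrite inE; apply/andP/idP => [[xA /eqP xe]|xe].
  have : oriented_loop L x \in loop_through L e by rewrite -xe !inE eqxx.
  case/set2P => E; first by rewrite -E oriented_loop_self.
  have := follows_loop fA (oriented_loop_self L x).
  have /(follows_loop fA) : x \in oriented_loop L (rev_dart e) by rewrite -E oriented_loop_self.
  by rewrite xA orientation_rev ?eA //; case/andP: fA.
rewrite (follows_loop fA xe) eA; split=> //; apply/eqP.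
by apply: loop_through_eq xe; rewrite !inE eqxx.
Qed.

(** Orienting every loop of L is the same as choosing arrows that follow L. *)
Lemma prod_loops_expand (T : comPzSemiRingType) L (phi : dart n j1 j2 -> T) :
  \prod_(l in loops L) \sum_(O in l) \prod_(f in O) phi f =
  \sum_(A | follows L A) \prod_(f in A) phi f.
Proof.
rewrite (big_distr_big_dep set0) /=.
(* The two inverse maps; the value set0 away from the loops is the default value
   that the index set of the expanded product prescribes. *)
pose pick A := [ffun l => if l \in loops L then orient L A l else set0].
pose join (g : {ffun {set {set dart n j1 j2}} -> {set dart n j1 j2}}) :=
  [set x | x \in g (loop_through L x)].
have loop_in x : loop_through L x \in loops L by apply/loopsP; exists x.
rewrite (reindex_onto pick join) /=; last first.
  move=> g /pfamilyP[/subsetP gs gl]; apply/ffunP => l; rewrite ffunE.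
  case: ifPn => [lL|lL]; last first.
    apply/esym/eqP; apply: contraNT lL => gl0; exact: gs.
  have [e le] := loopsP _ _ lL; apply/setP => x; rewrite !inE.
  apply/andP/idP => [[xg /eqP <-//]|xg]; suff E : loop_through L x = l by rewrite E eqxx.
  by rewrite le; apply: loop_through_eq xg; rewrite -le; exact: gl.
have pickE A x : (x \in pick A (loop_through L x)) = (x \in A).
  by rewrite ffunE loop_in inE eqxx andbT.
have joinK A : join (pick A) = A by apply/setP => x; rewrite inE pickE.
apply: eq_big => A; last first.
  move=> _; rewrite [RHS](partition_big (loop_through L) (mem (loops L))) //=.
  by apply: eq_bigr => l lL; apply: eq_bigl => x; rewrite ffunE lL inE.
rewrite joinK eqxx andbT; apply/pfamilyP/idP => [[_ gl]|fA]; last first.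
  split; first by apply/subsetP => l; rewrite !inE ffunE; case: ifP; rewrite ?eqxx.
  by move=> l /loopsP[e ->]; rewrite ffunE loop_in orient_mem.
have side x : pick A (loop_through L x) = oriented_loop L x \/
    pick A (loop_through L x) = oriented_loop L (rev_dart x).
  by apply/set2P; exact: gl.
apply/andP; split; apply/forallP => x; rewrite -!(pickE A).
  rewrite loop_through_rev; case: (side x) => ->.
    by rewrite oriented_loop_self (negPf (rev_notin_loop _ _)).
  by rewrite oriented_loop_self oriented_loop_rev (negPf (rev_notin_loop _ _)).
rewrite loop_through_next; case: (side x) => ->.
  by rewrite oriented_loop_self -(oriented_loop_next L x) oriented_loop_self.
rewrite -{1}(oriented_loop_rev_next L x) !oriented_loop_rev.
by rewrite !(negPf (rev_notin_loop _ _)).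
Qed.
End Expansion.

(** * Expanding the vertices *)

Lemma enum_dir : index_enum dir = [:: 0; 1; 2; 3].
Proof.
by apply: (inj_map val_inj); rewrite /index_enum -enumT val_enum_ord.
Qed.

Lemma forall_dir (P : pred dir) : [forall d, P d] = [&& P 0, P 1, P 2 & P 3].
Proof.
apply/forallP/and4P => [H|[H0 H1 H2 H3]]; first by split; exact: H.
exact: dir_ind.
Qed.

Lemma expiD (R : realType) (x y : R) : expi x * expi y = expi (x + y).
Proof.
rewrite /expi cosD sinD; apply/eqP; rewrite eq_complex /=.
by rewrite eqxx [X in X == _]addrC eqxx.
Qed.

Lemma expi0 (R : realType) : expi (0 : R) = 1.
Proof. by rewrite /expi cos0 sin0. Qed.

(** Phase of the turn made by the arrow that comes in along the edge in direction
d: it travels in direction d + 2 and leaves in direction partner b d. *)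
Definition vertex_phase (R : realType) (lam : R) (b : bool) (d : dir) : R[i] :=
  expi (lam * (if partner b d == d + 2 + 1 then 1 else -1)%:~R / 4).

(** Here o marks the edges whose arrow points out.  The sum runs over the
pairings that match incoming with outgoing arrows; it is empty unless two
arrows come in, so the ice rule need not be imposed on the loop side. *)
Lemma vertex_sum (R : realType) (lam : R) (o : dir -> bool) :
  \sum_(b | [forall d, o d != o (partner b d)])
    \prod_(d | ~~ o d) vertex_phase lam b d =
  if #|[set d | ~~ o d]| == 2%N then
    if [forall d, o d != o (d + 1)] then (2 * cos (lam / 2))%:C else 1
  else 0.
Proof.
move XE : (2 * cos (lam / 2))%:C => X.
rewrite big_mkcond big_bool /= !forall_dir.
rewrite -sum1dep_card ![\big[_/_]_(d | ~~ o d) _]big_mkcond /=.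
rewrite !unlock enum_dir /=.
rewrite (_ : partner true 0 = 1); last by apply: val_inj.
rewrite (_ : partner true 1 = 0); last by apply: val_inj.
rewrite (_ : partner true 2 = 3); last by apply: val_inj.
rewrite (_ : partner true 3 = 2); last by apply: val_inj.
rewrite (_ : partner false 0 = 3); last by apply: val_inj.
rewrite (_ : partner false 1 = 2); last by apply: val_inj.
rewrite (_ : partner false 2 = 1); last by apply: val_inj.
rewrite (_ : partner false 3 = 0); last by apply: val_inj.
rewrite (_ : 0 + 1 = 1 :> dir); last by apply: val_inj.
rewrite (_ : 1 + 1 = 2 :> dir); last by apply: val_inj.
rewrite (_ : 2 + 1 = 3 :> dir); last by apply: val_inj.
rewrite (_ : 3 + 1 = 0 :> dir); last by apply: val_inj.
pose z := expi (lam / 4); pose w := expi (- (lam / 4)).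
have phase b d : vertex_phase lam b d = if partner b d == d + 2 + 1 then z else w.
  by rewrite /vertex_phase /z /w; case: ifP; rewrite ?mulr1 ?mulrN1 ?mulNr.
rewrite !phase.
have zw : z * w = 1 by rewrite expiD subrr expi0.
have wz : w * z = 1 by rewrite mulrC.
have half : lam / 4 + lam / 4 = lam / 2 by field.
have zzww : z * z + w * w = X.
  by rewrite !expiD -opprD half expi_addN XE.
case: (o 0); case: (o 1); case: (o 2); case: (o 3) => //=.
all: by rewrite ?mulr1 ?mul1r ?mulr1 ?add0r ?addr0 ?zw ?wz // addrC.
Qed.

Section VertexExpansion.
Variables (R : realType) (n j1 j2 : nat).
Implicit Types (e f x : dart n j1 j2) (A : {set dart n j1 j2}).
Implicit Types (L : loop_config n j1 j2).

Lemma prod_by_head (T : comPzSemiRingType) A (F : dart n j1 j2 -> T) :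
  orientation A ->
  \prod_(f in A) F f =
  \prod_(v : vertex n j1 j2) \prod_(d : dir | (v, d) \notin A)
    F (rev_dart ((v, d) : dart n j1 j2)).
Proof.
move=> orA; rewrite (reindex_inj (inv_inj (@rev_dartK n j1 j2))) /=.
rewrite pair_big_dep /=; apply: eq_big => [[v d]|[v d] //].
by rewrite orientation_rev.
Qed.

Definition locally_follows A (v : vertex n j1 j2) (b : bool) : bool :=
  [forall d : dir, ((v, d) \in A) != ((v, partner b d) \in A)].

Lemma follows_local L A :
  follows L A = orientation A && [forall v, locally_follows A v (L v)].
Proof.
rewrite /follows; case orA : (orientation A) => //=.
apply/forallP/forallP => [H v|H e].
  apply/forallP => d; have := H (rev_dart (v, d)); rewrite next_rev_dart orientation_rev //=.
  by case: (_ \in A); case: (_ \in A).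
have /forallP/(_ (rev_dart e).2) := H (rev_dart e).1.
rewrite -surjective_pairing orientation_rev //.
rewrite -[in X in _ -> (X \in A) == _](rev_dartK e) next_rev_dart.
by case: (_ \in A); case: (_ \in A).
Qed.

Definition loop_phase (lam : R) L f : R[i] :=
  expi (lam * (turn_sign L f)%:~R / 4).

(** Both the condition to follow L and the phases are local, so that the sum over
L factors over the vertices. *)
Lemma sum_loop_phases (lam c : R) A : c = 2 * cos (lam / 2) -> orientation A ->
  \sum_(L | follows L A) \prod_(f in A) loop_phase lam L f =
  if arrow_config A then (arrow_weight c A)%:C else 0.
Proof.
move=> c_lam orA.
transitivity (\sum_(L in family (locally_follows A))
  \prod_(v : vertex n j1 j2) \prod_(d : dir | (v, d) \notin A)
    vertex_phase lam (L v) d).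
  apply: eq_big => [L|L _]; last first.
    rewrite prod_by_head //; apply: eq_bigr => v _; apply: eq_bigr => d _.
    by rewrite /loop_phase /turn_sign next_rev_dart.
  rewrite follows_local orA /=; apply/forallP/familyP => H v; exact: H.
rewrite -(bigA_distr_big_dep (locally_follows A) (fun v b =>
  \prod_(d : dir | (v, d) \notin A) vertex_phase lam b d)) /=.
have in_out v : [set d : dir | rev_dart ((v, d) : dart n j1 j2) \in A] =
    [set d : dir | (v, d) \notin A].
  by apply/setP => d; rewrite !inE orientation_rev.
rewrite /arrow_config orA /=.
under eq_bigr do rewrite (vertex_sum lam (fun d => (_, d) \in A)) -in_out.
case: ifPn => [/forallP ice|]; last first.
  rewrite negb_forall => /existsP[v /negPf vN].
  by rewrite (bigD1 v) //= vN mul0r.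
rewrite /arrow_weight rmorphXn -prodr_const /= [RHS]big_mkcond /=.
by apply: eq_bigr => v _; rewrite ice -c_lam inE.
Qed.

Definition zipper_phase (Gamma : seq (dart n j1 j2)) f : R[i] :=
  'i ^+ count_mem f Gamma * (- 'i) ^+ count_mem (rev_dart f) Gamma.

Lemma count_set A (s : seq (dart n j1 j2)) :
  count [in A] s = (\sum_(f in A) count_mem f s)%N.
Proof.
elim: s => [|x s IH] /=; first by rewrite big1.
rewrite big_split /= IH; congr (_ + _)%N.
case: (boolP (x \in A)) => xA.
  rewrite (bigD1 x) //= eqxx big1 ?addn0 // => f /andP[_ fx].
  by rewrite eq_sym (negPf fx).
by rewrite big1 // => f fA; case: eqP => // xf; rewrite xf fA in xA.
Qed.

Lemma epsilon_prod Gamma A :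
  epsilon R Gamma A = \prod_(f in A) zipper_phase Gamma f.
Proof.
rewrite /epsilon !count_set !expr_sum /= big_split /=; congr (_ * _).
rewrite (reindex_inj (inv_inj (@rev_dartK n j1 j2))) /=.
by apply: eq_bigl => f; rewrite rev_darts_mem rev_dartK.
Qed.

Lemma loop_factor_prod (lam : R) Gamma L A :
  expi (lam * winding R L A) * epsilon R Gamma A =
  \prod_(f in A) (loop_phase lam L f * zipper_phase Gamma f).
Proof.
rewrite big_split /= epsilon_prod; congr (_ * _).
rewrite winding_sum rmorph_sum /= mulr_suml mulr_sumr.
rewrite (big_morph (@expi R) (fun s t => esym (expiD s t)) (expi0 R)).
by apply: eq_bigr => f _; rewrite mulrA.
Qed.

(** Both sides are the sum of the phases over all pairs of a loop configuration
and an orientation that follows it. *)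
Lemma partition_identity (lam c : R) Gamma : c = 2 * cos (lam / 2) ->
  \sum_(A : {set dart n j1 j2} | arrow_config A)
     (arrow_weight c A)%:C * epsilon R Gamma A =
  \sum_(L : loop_config n j1 j2) \prod_(l in loops L)
     \sum_(O in l) expi (lam * winding R L O) * epsilon R Gamma O.
Proof.
move=> c_lam; apply/esym.
transitivity (\sum_(L : loop_config n j1 j2) \sum_(A | follows L A)
   (\prod_(f in A) loop_phase lam L f) * epsilon R Gamma A).
  apply: eq_bigr => L _; under eq_bigr do under eq_bigr do rewrite loop_factor_prod.
  rewrite prod_loops_expand; apply: eq_bigr => A _.
  by rewrite big_split epsilon_prod.
rewrite (exchange_big_dep (@orientation n j1 j2)) /=; last by move=> L A _ /andP[].
rewrite [RHS]big_mkcond [LHS]big_mkcond /=; apply: eq_bigr => A _.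
case orA : (orientation A); last by rewrite /arrow_config orA.
by rewrite -mulr_suml (sum_loop_phases c_lam orA); case: ifP => //; rewrite mul0r.
Qed.
End VertexExpansion.

(** * Heights *)

(** The box has its i-th coordinates in -h + 1, ..., h, where h is half the side
of the torus; they are numbered here from 0, and the cut lies between the last
and the first one. *)
Definition box_point (m h i : nat) : 'Z_m := i%:R + 1 - h%:R.

Definition box_coord (m h : nat) (x : 'Z_m) : nat :=
  nat_of_ord (x + h%:R - 1 : 'Z_m).

Arguments box_point {m}.

Lemma box_pointS (m h i : nat) : box_point h i.+1 = box_point h i + 1 :> 'Z_m.
Proof. by rewrite /box_point mulrSr addrAC. Qed.

Lemma box_coordK (m h : nat) (x : 'Z_m) : box_point h (box_coord h x) = x.
Proof. by rewrite /box_point /box_coord natr_Zp subrK addrK. Qed.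

Lemma box_coord_succ (m h : nat) (x : 'Z_m) : (0 < h)%N -> m = (2 * h)%N ->
  x != h%:R -> box_coord h (x + 1) = (box_coord h x).+1.
Proof.
move=> h0 mE xh; have m1 : (1 < m)%N by rewrite mE; lia.
rewrite /box_coord [x + 1 + _]addrAC addrK.
set y := x + h%:R - 1; have yE : x + h%:R = (nat_of_ord y).+1%:R.
  by rewrite mulrSr natr_Zp subrK.
rewrite yE val_Zp_nat // modn_small // ltn_neqAle.
have -> : ((nat_of_ord y).+1 <= m)%N by rewrite -[m in (_ <= m)%N]Zp_cast.
rewrite andbT; apply: contraNneq xh => ym.
apply/eqP/(addIr h%:R); rewrite yE ym pchar_Zp // -natrD addnn -mul2n -mE.
by rewrite pchar_Zp.
Qed.

Section Heights.
Variables n j1 j2 : nat.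
Hypotheses (n_gt0 : (0 < n)%N) (j1_gt0 : (0 < j1)%N) (j2_gt0 : (0 < j2)%N).
Implicit Types (A : {set dart n j1 j2}) (f : face n j1 j2) (d : dir).

Definition signed_step A f d : int :=
  if right_to_left f d \in A then 1 else -1.

Definition net_crossing A f (p : seq dir) : int :=
  (count [in A] (crossings f p))%:Z - (count [in rev_darts A] (crossings f p))%:Z.

Lemma net_crossing_cons A f d p : orientation A ->
  net_crossing A f (d :: p) = signed_step A f d + net_crossing A (dual_step f d) p.
Proof.
move=> orA; rewrite /net_crossing /= rev_darts_mem orientation_rev //.
by rewrite /signed_step; case: (_ \in A) => /=; lia.
Qed.

Lemma dual_step_opp f d : dual_step (dual_step f d) (d + 2) = f.
Proof. by rewrite /dual_step dvec_opp addrK. Qed.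

Lemma right_to_left_opp f d :
  right_to_left (dual_step f d) (d + 2) = rev_dart (right_to_left f d).
Proof.
rewrite /right_to_left /rev_dart /dart_head /corner /dual_step /=.
rewrite (_ : d + 2 + 1 = d + 1 + 2); last by rewrite addrAC.
congr (_, _); rewrite -!addrA; congr (_ + _).
by move: d; apply: dir_ind; congr (_, _); rewrite /= ?addr0 ?add0r ?addNr ?subrr.
Qed.

Lemma signed_step_opp A f d : orientation A ->
  signed_step A (dual_step f d) (d + 2) = - signed_step A f d.
Proof.
move=> orA; rewrite /signed_step right_to_left_opp orientation_rev //.
by case: (_ \in A).
Qed.

(** The two ways around the four faces at a vertex cross the same four arrows, with
opposite signs; two of them come in and two go out. *)
Lemma curl_free A f : arrow_config A ->
  signed_step A f 0 + signed_step A (dual_step f 0) 1 =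
  signed_step A f 1 + signed_step A (dual_step f 1) 0.
Proof.
case/andP=> orA /forallP ice; pose v : vertex n j1 j2 := f + (1, 1).
have E0 : right_to_left f 0 = rev_dart (v, 3 : dir).
  rewrite /right_to_left /rev_dart /dart_head /corner /v /=; congr (_, _); last exact: val_inj.
  by rewrite -addrA; congr (_ + (_, _)); rewrite /= ?addr0 ?subrr.
have E1 : right_to_left (dual_step f 0) 1 = rev_dart (v, 0 : dir).
  rewrite /right_to_left /rev_dart /dart_head /corner /v /=; congr (_, _); last exact: val_inj.
  by rewrite /dual_step -!addrA; congr (_ + (_, _)); rewrite /= ?addr0 ?add0r.
have E2 : right_to_left f 1 = (v, 2) by congr (_, _); exact: val_inj.
have E3 : right_to_left (dual_step f 1) 0 = (v, 1).
  rewrite /right_to_left /corner /v /=; congr (_, _); last exact: val_inj.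
  by rewrite /dual_step -!addrA; congr (_ + (_, _)); rewrite /= ?addr0 ?add0r.
have := ice v; rewrite -sum1dep_card big_mkcond unlock enum_dir /=.
rewrite /signed_step E0 E1 E2 E3 !orientation_rev //.
by do 4!case: (_ \in A).
Qed.

(** The height gained on the path that runs along the bottom row of the box and
then up a column. *)
Definition potential A f : int :=
  let x := box_coord (n * j1) f.1 in let y := box_coord (n * j2) f.2 in
  \sum_(i < x) signed_step A (box_point (n * j1) i, box_point (n * j2) 0) 0 +
  \sum_(j < y) signed_step A (f.1, box_point (n * j2) j) 1.

Lemma dual_step_east (x : 'Z_(2 * n * j1)) (y : 'Z_(2 * n * j2)) :
  dual_step ((x, y) : face n j1 j2) 0 = (x + 1, y).
Proof. by congr (_, _); rewrite /= ?addr0. Qed.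

Lemma dual_step_north (x : 'Z_(2 * n * j1)) (y : 'Z_(2 * n * j2)) :
  dual_step ((x, y) : face n j1 j2) 1 = (x, y + 1).
Proof. by congr (_, _); rewrite /= ?addr0. Qed.

Lemma dual_step_west (x : 'Z_(2 * n * j1)) (y : 'Z_(2 * n * j2)) :
  dual_step ((x, y) : face n j1 j2) 2 = (x - 1, y).
Proof. by congr (_, _); rewrite /= ?addr0. Qed.

Lemma dual_step_south (x : 'Z_(2 * n * j1)) (y : 'Z_(2 * n * j2)) :
  dual_step ((x, y) : face n j1 j2) 3 = (x, y - 1).
Proof. by congr (_, _); rewrite /= ?addr0. Qed.

Lemma potential_north A f : ~~ crosses_cut f 1 ->
  potential A (dual_step f 1) - potential A f = signed_step A f 1.
Proof.
case: f => x y /= cut; rewrite dual_step_north /potential /=.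
rewrite box_coord_succ ?muln_gt0 ?n_gt0 ?mulnA // big_ord_recr /= box_coordK.
lra.
Qed.

Lemma potential_east A f : arrow_config A -> ~~ crosses_cut f 0 ->
  potential A (dual_step f 0) - potential A f = signed_step A f 0.
Proof.
move=> Aok; case: f => x y /= cut; rewrite dual_step_east /potential /=.
rewrite box_coord_succ ?muln_gt0 ?n_gt0 ?mulnA // big_ord_recr /= box_coordK.
(* Pushes the horizontal step up the column, one vertex at a time. *)
have column k : signed_step A (x, box_point (n * j2) 0) 0 +
    \sum_(j < k) signed_step A (x + 1, box_point (n * j2) j) 1 =
    signed_step A (x, box_point (n * j2) k) 0 +
    \sum_(j < k) signed_step A (x, box_point (n * j2) j) 1.
  elim: k => [|k IH]; first by rewrite !big_ord0.
  rewrite !big_ord_recr /= addrA IH.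
  have := curl_free (x, box_point (n * j2) k) Aok.
  rewrite dual_step_east dual_step_north -(box_pointS _ (n * j2) k) => curl.
  by rewrite addrAC curl addrC [RHS]addrCA; congr (_ + _); exact: addrC.
have cancel (s a b t e : int) : a + b = e + t -> s + a + b - (s + t) = e.
  by clear; lra.
by apply: cancel; rewrite column box_coordK.
Qed.

(** The cut is two-sided because h and -h agree modulo 2 h. *)
Lemma crosses_cut_opp f d :
  crosses_cut (dual_step f d) (d + 2) = crosses_cut f d.
Proof.
have half (j : nat) : (0 < j)%N ->
    ((n * j)%:R = - (n * j)%:R :> 'Z_(2 * n * j)).
  move=> j0; apply/eqP; rewrite -addr_eq0 -natrD addnn -mul2n mulnA pchar_Zp //.
  by have := muln_gt0 n j; rewrite n_gt0 j0 -mulnA; lia.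
case: f => x y; move: d; apply: dir_ind.
- rewrite (_ : 0 + 2 = 2) ?dual_step_east; last exact: val_inj.
  rewrite -[LHS]/(x + 1 == - (n * j1)%:R + 1) -[RHS]/(x == (n * j1)%:R).
  by rewrite -half // (inj_eq (addIr 1)).
- rewrite (_ : 1 + 2 = 3) ?dual_step_north; last exact: val_inj.
  rewrite -[LHS]/(y + 1 == - (n * j2)%:R + 1) -[RHS]/(y == (n * j2)%:R).
  by rewrite -half // (inj_eq (addIr 1)).
- rewrite (_ : 2 + 2 = 0) ?dual_step_west; last exact: val_inj.
  rewrite -[LHS]/(x - 1 == (n * j1)%:R) -[RHS]/(x == - (n * j1)%:R + 1).
  by rewrite -half // subr_eq.
- rewrite (_ : 3 + 2 = 1) ?dual_step_south; last exact: val_inj.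
  rewrite -[LHS]/(y - 1 == (n * j2)%:R) -[RHS]/(y == - (n * j2)%:R + 1).
  by rewrite -half // subr_eq.
Qed.

Lemma potential_step A f d : arrow_config A -> ~~ crosses_cut f d ->
  potential A (dual_step f d) - potential A f = signed_step A f d.
Proof.
move=> Aok.
have back g e : (forall g, ~~ crosses_cut g e ->
      potential A (dual_step g e) - potential A g = signed_step A g e) ->
    ~~ crosses_cut g (e + 2) ->
    potential A (dual_step g (e + 2)) - potential A g = signed_step A g (e + 2).
  have orA : orientation A by case/andP: Aok.
  move=> H cut; have := H (dual_step g (e + 2)).
  have := crosses_cut_opp g (e + 2); have := dual_step_opp g (e + 2).
  have := signed_step_opp g (e + 2) orA; rewrite dir_oppK => -> -> ->.
  by move=> /(_ cut) E; apply: oppr_inj; rewrite opprB.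
move: d f; apply: dir_ind => f; first exact: potential_east.
- exact: potential_north.
- rewrite (_ : 2 = 0 + 2); last exact: val_inj.
  by apply: back => g; exact: potential_east.
- rewrite (_ : 3 = 1 + 2); last exact: val_inj.
  by apply: back => g; exact: potential_north.
Qed.

(** In particular the left-hand side depends on the endpoints of the path only. *)
Lemma net_crossing_box_path A f g p : arrow_config A -> box_path f g p ->
  net_crossing A f p = potential A g - potential A f.
Proof.
move=> Aok /andP[+ /eqP <-]; elim: p f => [|d p IH] f /=.
  by rewrite subrr /net_crossing.
case/andP=> cut av; rewrite net_crossing_cons; last by case/andP: Aok.
by rewrite (IH _ av) -(potential_step Aok cut) addrC addrA subrK.
Qed.
End Heights.

(** * Spins *)

Section Spins.
Variables (R : realType) (n j1 j2 : nat).
Hypotheses (n_gt0 : (0 < n)%N) (j1_gt0 : (0 < j1)%N) (j2_gt0 : (0 < j2)%N).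
Variables (u0 : face n j1 j2) (gamma : face n j1 j2 -> seq dir).
Hypothesis gamma_path : forall f, box_path u0 f (gamma f).
Implicit Types (A : {set dart n j1 j2}) (f : face n j1 j2) (d : dir).

Lemma imaginary_unit : ('i : R[i]) \is a GRing.unit.
Proof. by rewrite unitfE -sqrf_eq0 sqr_i oppr_eq0 oner_eq0. Qed.

Lemma heightE A h0 f : height u0 gamma A h0 f = (-1) ^+ h0 + net_crossing A u0 (gamma f).
Proof. by rewrite /height /net_crossing addrA. Qed.

Lemma spin_transport A h0 f g p : arrow_config A -> box_path f g p ->
  spin R u0 gamma A h0 g = spin R u0 gamma A h0 f * 'i ^ net_crossing A f p.
Proof.
move=> Aok pfg; rewrite /spin -expfzDr; last by have := imaginary_unit; rewrite unitfE.
congr (_ ^ _); rewrite !heightE -addrA; congr (_ + _).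
rewrite (net_crossing_box_path n_gt0 j1_gt0 j2_gt0 Aok (gamma_path g)).
rewrite (net_crossing_box_path n_gt0 j1_gt0 j2_gt0 Aok (gamma_path f)).
rewrite (net_crossing_box_path n_gt0 j1_gt0 j2_gt0 Aok pfg).
by rewrite [RHS]addrC subrKA.
Qed.

Lemma epsilonE A (G : seq (dart n j1 j2)) :
  epsilon R G A = 'i ^ ((count [in A] G)%:Z - (count [in rev_darts A] G)%:Z).
Proof.
rewrite expfzDr; last by have := imaginary_unit; rewrite unitfE.
rewrite /epsilon; congr (_ * _).
rewrite -exprz_inv -exprnP; congr (_ ^+ _).
apply: (mulrI imaginary_unit); rewrite divrr ?imaginary_unit // mulrN -expr2 sqr_i opprK.
by [].
Qed.

Lemma epsilon_flatten A (Gs : seq (seq (dart n j1 j2))) :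
  epsilon R (flatten Gs) A = \prod_(G <- Gs) epsilon R G A.
Proof.
elim: Gs => [|G Gs IH]; first by rewrite big_nil /epsilon /= mulr1.
by rewrite big_cons -IH /epsilon /= !count_cat !exprD mulrACA.
Qed.

Variable black : pred (face n j1 j2).
Hypotheses (chess : chessboard black) (u0_white : ~~ black u0).

(** The square of i^h is (-1)^h, and the parity of the height alternates with the
colour of the face. *)
Lemma spin_sqr A h0 f : orientation A ->
  spin R u0 gamma A h0 f ^+ 2 = if black f then 1 else -1.
Proof.
move=> orA; have m1 : (-1 : R[i]) != 0 by rewrite oppr_eq0 oner_eq0.
have sq (z : int) : ('i ^ z) ^+ 2 = (-1 : R[i]) ^ z.
  by rewrite -sqr_i !exprnP !exprz_exp mulrC.
have colour p g : (if black (dual_end g p) then 1 else -1 : R[i]) =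
    (if black g then 1 else -1) * (-1) ^ net_crossing A g p.
  elim: p g => [|d p IH] g /=; first by rewrite mulr1.
  rewrite IH net_crossing_cons // [in RHS]expfzDr // mulrA; congr (_ * _).
  rewrite chess /signed_step.
  by case: (_ \in A); case: (black g); rewrite ?expr1z ?exprN1 ?invrN1 ?mul1r ?mulrNN ?mulr1.
rewrite /spin sq heightE expfzDr //.
have /andP[_ /eqP E] := gamma_path f; rewrite -[f in RHS]E colour (negPf u0_white).
by case: h0; rewrite ?expr0 ?expr1 ?expr1z ?exprN1 ?invrN1.
Qed.

Section Product.
Variables (k l : nat) (u : 'I_(2 * k) -> face n j1 j2) (v : 'I_(2 * l) -> face n j1 j2).
Hypotheses (u_black : forall i, black (u i)) (v_white : forall j, ~~ black (v j)).
Variables (S : {set 'I_(2 * k) + 'I_(2 * l)}) (a b : 'I_(k + l) -> 'I_(2 * k) + 'I_(2 * l)).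
Variable p : 'I_(k + l) -> seq dir.
Hypotheses (S_half : #|S| = (k + l)%N) (p_zipper : zipper u v S a b p).

Lemma prod_image (T : finType) (F : T -> R[i]) m (g : 'I_m -> T) (B : {set T}) :
  injective g -> (forall t, g t \in B) -> #|B| = m ->
  \prod_(x in B) F x = \prod_(t < m) F (g t).
Proof.
move=> g_inj gB Bm.
have <- : [set g t | t in 'I_m] = B.
  apply/eqP; rewrite eqEcard card_imset // card_ord Bm leqnn andbT.
  by apply/subsetP => _ /imsetP[t _ ->].
by rewrite big_imset //=; move=> x y _ _; exact: g_inj.
Qed.

(** Pairing each source with its sink leaves the squared spins of the sources
and, along the paths, epsilon. *)
Lemma spins_product A h0 : arrow_config A ->
  (\prod_(i < 2 * k) spin R u0 gamma A h0 (u i)) *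
  (\prod_(j < 2 * l) spin R u0 gamma A h0 (v j)) =
  (-1) ^+ white_sinks S * epsilon R (zipper_edges u v a p) A.
Proof.
move=> Aok; have [a_inj b_inj aS bS path] := p_zipper.
have orA : orientation A by case/andP: Aok.
have sinks_parity : odd #|[set j | inr j \in S]| = odd (white_sinks S).
  have same_parity x y : (x + y = 2 * l)%N -> odd x = odd y by clear; lia.
  apply: same_parity; transitivity #|'I_(2 * l)|; last exact: card_ord.
  rewrite -(cardsC [set j | inr j \in S]) /white_sinks; congr (_ + _)%N.
  by apply: eq_card => j; rewrite !inE.
pose s x := spin R u0 gamma A h0 (marked u v x).
have SC_half : #|~: S| = (k + l)%N.
  by have := cardsC S; rewrite card_sum !card_ord S_half; lia.
transitivity (\prod_x s x); first by rewrite [RHS]big_sumType; congr (_ * _).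
rewrite (bigID (mem S)) /= (prod_image s a_inj aS S_half).
rewrite [X in _ * X](eq_bigl (fun x => x \in ~: S)) => [|x]; last by rewrite in_setC.
rewrite (prod_image s b_inj _ SC_half) => [|t]; last by rewrite inE bS.
rewrite -big_split /=.
under eq_bigr do rewrite {2}/s (spin_transport h0 Aok (path _)) mulrA -expr2.
rewrite big_split /= -(prod_image (fun x => s x ^+ 2) a_inj aS S_half); congr (_ * _).
  rewrite big_mkcond big_sumType /= [X in X * _]big1 => [|i _]; last first.
    by rewrite spin_sqr // u_black if_same.
  rewrite mul1r -big_mkcond /=.
  under eq_bigr do rewrite spin_sqr // (negPf (v_white _)).
  by rewrite prodr_const -[LHS]signr_odd -[RHS]signr_odd -sinks_parity cardsE.
rewrite /zipper_edges epsilon_flatten big_map big_enum /=.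
by apply: eq_bigr => t _; rewrite epsilonE.
Qed.
End Product.
End Spins.

(** As c^2 >= 3, the square root of q is c^2 - 2, which is 2 cos lam; the formula
for c is the duplication of the cosine. *)
Lemma vertex_weight_half_angle (R : realType) (c lam : R) :
  Num.sqrt 3 <= c <= 2 -> 0 <= lam <= pi / 3 ->
  Num.sqrt (qpar c) = 2 * cos lam ->
  c = 2 * cos (lam / 2) /\ cos lam != 0.
Proof.
move=> /andP[c3 c2] /andP[lam0 lam3] q_lam.
have c0 : 0 <= c by apply: le_trans c3; exact: sqrtr_ge0.
have csq : 3 <= c ^+ 2.
  by rewrite -[3](sqr_sqrtr (a := 3)) ?ler0n // ler_sqr ?nnegrE ?sqrtr_ge0.
have qE : c ^+ 2 - 2 = 2 * cos lam.
  by rewrite -q_lam /qpar sqrtr_sqr ger0_norm //; lra.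
have half : lam = lam / 2 + lam / 2 by field.
have cos_half : 0 <= cos (lam / 2).
  apply: cos_ge0_pihalf; have := pi_gt0 R => pi0; apply/andP; split; lra.
have dup : cos lam = 2 * cos (lam / 2) ^+ 2 - 1.
  by rewrite {1}half cosD -expr2 -expr2 sin2cos2; ring.
split; last by apply/eqP => l0; move: qE csq; rewrite l0; lra.
apply/eqP; rewrite -(@eqrXn2 _ 2) ?mulr_ge0 //; apply/eqP.
rewrite exprMn; move: qE dup; lra.
Qed.

Theorem lemma2p1 (R : realType) (n j1 j2 : nat)
  (n_gt0 : (0 < n)%N) (j1_gt0 : (0 < j1)%N) (j2_gt0 : (0 < j2)%N)
  (c lam : R) (c_range : Num.sqrt 3 <= c <= 2)
  (lam_range : 0 <= lam <= pi / 3)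
  (lam_q : Num.sqrt (qpar c) = 2 * cos lam)
  (black : pred (face n j1 j2)) (black_chessboard : chessboard black)
  (u0 : face n j1 j2) (u0_white : ~~ black u0) (u0_origin : next_to u0 0)
  (gamma : face n j1 j2 -> seq dir)
  (gamma_path : forall f : face n j1 j2, box_path u0 f (gamma f))
  (k l : nat)
  (u : 'I_(2 * k) -> face n j1 j2) (u_black : forall i, black (u i))
  (v : 'I_(2 * l) -> face n j1 j2) (v_white : forall j, ~~ black (v j))
  (S : {set 'I_(2 * k) + 'I_(2 * l)}) (S_half : #|S| = (k + l)%N)
  (a b : 'I_(k + l) -> 'I_(2 * k) + 'I_(2 * l)) (p : 'I_(k + l) -> seq dir)
  (p_zipper : zipper u v S a b p) :
  E_mu c (fun A h0 => (\prod_(i < 2 * k) spin R u0 gamma A h0 (u i)) *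
                      (\prod_(j < 2 * l) spin R u0 gamma A h0 (v j))) =
  (-1) ^+ white_sinks S *
  E_phi c (fun L => \prod_(w in loops L)
                      rho lam (zipper_edges u v a p) L w).
Proof.
have [c_lam cos0] := vertex_weight_half_angle c_range lam_range lam_q.
pose G := zipper_edges u v a p.
pose Z G' := \sum_(A : {set dart n j1 j2} | arrow_config A)
  (arrow_weight c A)%:C * epsilon R G' A.
have Z0 : Z [::] = (\sum_(A : {set dart n j1 j2} | arrow_config A) arrow_weight c A)%:C.
  by rewrite rmorph_sum; apply: eq_bigr => A _; rewrite /epsilon /= !mulr1.
have weight L := loop_weight_prod L lam_q cos0.
have loop_denom : (\sum_L @loop_weight R n j1 j2 c L)%:C = Z [::].
  rewrite /Z (partition_identity _ c_lam) rmorph_sum; apply: eq_bigr => L _ /=.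
  rewrite weight; apply: eq_bigr => w _; apply: eq_bigr => O _.
  by rewrite /epsilon /= !mulr1.
(* The normalization of rho cancels against the weight of the loop. *)
have loop_num : \sum_L (@loop_weight R n j1 j2 c L)%:C *
    (\prod_(w in loops L) rho lam G L w) = Z G.
  rewrite /Z (partition_identity _ c_lam); apply: eq_bigr => L _.
  rewrite weight -big_split; apply: eq_bigr => w wL /=.
  rewrite /rho mulrC divfK //; have [e ->] := loopsP _ _ wL.
  rewrite sum_expi_winding; case: ifP => _; rewrite fmorph_eq0 ?pnatr_eq0 //.
  by rewrite mulf_neq0 ?pnatr_eq0.
(* The coin doubles both the numerator and the denominator. *)
have coin (F : {set dart n j1 j2} -> bool -> R[i]) :
    \sum_(x : {set dart n j1 j2} * bool | arrow_config x.1) F x.1 x.2 =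
    \sum_(A : {set dart n j1 j2} | arrow_config A) (F A true + F A false).
  transitivity (\sum_(A : {set dart n j1 j2} | arrow_config A) \sum_(h : bool) F A h).
    rewrite pair_big_dep /=; apply: eq_bigl => x; by rewrite andbT.
  by apply: eq_bigr => A _; rewrite big_bool.
rewrite /E_phi /expect loop_denom loop_num /E_mu /expect.
have -> : (\sum_(x : {set dart n j1 j2} * bool | arrow_config x.1) arrow_weight c x.1)%:C =
    2 * Z [::].
  rewrite rmorph_sum (coin (fun A _ => (arrow_weight c A)%:C)) Z0 rmorph_sum /= mulr_sumr.
  by apply: eq_bigr => A _; rewrite mulr_natl mulr2n.
have -> : \sum_(x : {set dart n j1 j2} * bool | arrow_config x.1)
    (arrow_weight c x.1)%:C *
    ((\prod_(i < 2 * k) spin R u0 gamma x.1 x.2 (u i)) *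
     (\prod_(j < 2 * l) spin R u0 gamma x.1 x.2 (v j))) =
    2 * ((-1) ^+ white_sinks S * Z G).
  rewrite (coin (fun A h => (arrow_weight c A)%:C *
    ((\prod_(i < 2 * k) spin R u0 gamma A h (u i)) *
     (\prod_(j < 2 * l) spin R u0 gamma A h (v j))))) /Z !mulr_sumr.
  apply: eq_bigr => A Aok.
  rewrite !(spins_product R n_gt0 j1_gt0 j2_gt0 gamma_path black_chessboard u0_white
    u_black v_white S_half p_zipper _ Aok).
  by rewrite [RHS]mulr_natl mulr2n; congr (_ + _); exact: mulrCA.
by rewrite -mulf_div divff ?pnatr_eq0 // mul1r mulrA.
Qed.
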